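(* Let $(m,\chi)$ be a pair where $0\neq m\in\mathfrak{sl}_2(F)$ and $\chi$ is a character of $Z_G(m)$ such that: (a) $V_{m,\chi}^{K_\epsilon}$ is finite-dimensional and the operator by which $T_x$ acts on $V_{m,\chi}^{K_\epsilon}$ does not depend on $x\in\kappa$; (b) if $m$ has an eigenvalue in $F\smallsetminus\{0\}$ and $\mathfrak{c}(\chi)=0$, then $z$ is a root of unity for all $z\in\mathrm{Im}(\chi)$. Then every eigenvalue of $T_0$ acting on $V_{m,\chi}^{K_\epsilon}$ is expressible as the sum of two complex-conjugate $q$-Weil numbers, where a $q$-Weil number is an algebraic integer all of whose conjugates have absolute value $q^{1/2}$.
   Context: $F$ is a non-Archimedean local field of characteristic different from $2$, $\mathcal{O}$ its ring of integers, $\varpi$ a generator of the maximal ideal, $\kappa=\mathcal{O}/\varpi\mathcal{O}$, $q=|\kappa|$. For a ring $A$, $A_\epsilon:=A[\epsilon]/(\epsilon^2)$. Put $G=\mathrm{PGL}_2(F)$, $K=\mathrm{PGL}_2(\mathcal{O})$, $G_\epsilon=\mathrm{PGL}_2(F_\epsilon)$, $K_\epsilon=\mathrm{PGL}_2(\mathcal{O}_\epsilon)$, $\mathfrak{g}=\mathfrak{sl}_2(F)$. Elements of $\mathrm{PGL}_2$ are written as matrices in $\mathrm{GL}_2$. One has $G_\epsilon=(1+\epsilon\mathfrak{g})\rtimes G$. Hecke operators: for $x\in\kappa$ with a lift $\tilde x\in\mathcal{O}$, let $g_x=\begin{pmatrix}\varpi+\epsilon\tilde x&0\\0&1\end{pmatrix}\in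 G_\epsilon$; the double coset $K_\epsilon g_xK_\epsilon$ does not depend on the lift. $T_x:=q^{-1}\,\mathrm{ch}_{K_\epsilon g_xK_\epsilon}$ in the Hecke algebra of $(G_\epsilon,K_\epsilon)$ (Haar measure with $\mathrm{vol}(K_\epsilon)=1$); on the $K_\epsilon$-invariants $V^{K_\epsilon}$ of a smooth representation $V$ of $G_\epsilon$ it acts by $T_xv=q^{-1}\sum_{gK_\epsilon\subset K_\epsilon g_xK_\epsilon}gv$. Representations: fix an additive character $\psi_0:F\to\mathrm{U}(1)$ with $\{x\in F:\psi_0|_{x\mathcal{O}}=1\}=\mathcal{O}$, and for $m\in\mathfrak{g}$ let $\psi_m(m')=\psi_0(\mathrm{tr}(mm'))$ for $m'\in\mathfrak{g}$. $Z_G(m)$ is the stabilizer of $m$ in $G$ under conjugation. A character is a smooth homomorphism to $\mathbb{C}^\times$. For a character $\chi$ of $Z_G(m)$, $V_{m,\chi}$ is the space of smooth functions $f:G_\epsilon\to\mathbb{C}$ such that $f((1+\epsilon m')g)=\psi_m(m')f(g)$ for $m'\in\mathfrak{g}$, $g\in G$; $f(zg)=\chi(z)f(g)$ for $z\in Z_G(m)$, $g\in G$; and the support of $f|_G$ is compact modulo left translation by $Z_G(m)$. $G_\epsilon$ acts by right translation. If $m$ has an eigenvalue $c\in F\smallsetminus\{0\}$, then after conjugation $m=\mathrm{diag}(c,-c)$ and $Z_G(m)=\{\mathrm{diag}(x,1):x\in F^\times\}\cong F^\times$; $\mathfrak{c}(\chi)$ denotes the conductor of $\chi$ viewed as a character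 of $F^\times$, i.e. the smallest $\ell\ge 0$ such that $\chi$ is trivial on $\mathcal{O}^\times$ (if $\ell=0$) or on $1+\varpi^\ell\mathcal{O}$ (if $\ell\ge1$). *)

(* Defs.v *)
From HB Require Import structures.
From mathcomp Require Import all_boot all_order all_algebra.
From mathcomp Require Import finmap.
From mathcomp Require Import all_classical all_reals all_analysis.
From mathcomp Require Import complex qpoly.

Set Implicit Arguments.
Unset Strict Implicit.
Unset Printing Implicit Defensive.

Import Order.TTheory GRing.Theory Num.Theory.
Local Open Scope classical_set_scope.
Local Open Scope quotient_scope.
Local Open Scope ring_scope.

#[short(type="topComUnitRingType")]
HB.structure Definition TopComUnitRing :=
  {A of GRing.ComUnitRing A & Topological A}.

(* A field that is complete for a discrete valuation with finite residue field.
   [ordv 0] is unspecified ("v(0) = +oo" is always treated separately). *)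
HB.mixin Record isNonarchLocal F of GRing.Field F & Uniform F := {
  ordv : F -> int;
  ordvM : forall x y : F, x != 0 -> y != 0 -> ordv (x * y) = ordv x + ordv y;
  ordvD : forall x y : F, x != 0 -> y != 0 -> x + y != 0 ->
    Num.min (ordv x) (ordv y) <= ordv (x + y);
  ordv_surj : forall n : int, exists2 x : F, x != 0 & ordv x = n;
  entourage_ordvE : entourage = filter_from [set: int]
    (fun n => [set xy : F * F | xy.1 = xy.2 \/ n <= ordv (xy.1 - xy.2)]);
  cauchy_converges : forall G : set_system F, ProperFilter G -> cauchy G ->
    exists x : F, G --> x;
  residue_finite : exists s : seq F, forall x : F, x = 0 \/ 0 <= ordv x ->
    exists2 y, y \in s & x = y \/ 1 <= ordv (x - y)
}.

#[short(type="nonarchLocalFieldType")]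
HB.structure Definition NonarchLocalField :=
  {F of GRing.Field F & Uniform F & isNonarchLocal F}.

Section LocalField.
Variable F : nonarchLocalFieldType.

Definition integers : set F := [set x | x = 0 \/ 0 <= ordv x].

Definition maximal_ideal : set F := [set x | x = 0 \/ 1 <= ordv x].

Definition uniformizer (varpi : F) : Prop :=
  maximal_ideal = [set varpi * x | x in integers].

Definition residue_field : set (set F) :=
  [set [set y | maximal_ideal (y - x)] | x in integers].

Definition residue_card : nat := #|` fset_set residue_field|%fset.

End LocalField.

Section LocallyConstant.
Variables (T : topologicalType) (C : Type).

(* In the totally disconnected setting, smooth means locally constant. *)
Definition smooth (f : T -> C) : Prop := forall x, \forall y \near x, f y = f x.

Definition smooth_on (A : set T) (f : T -> C) : Prop :=
  forall x, A x -> \forall y \near x, A y -> f y = f x.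

End LocallyConstant.

Section PGL2.
Variable A : topComUnitRingType.

Record GL2 : Type :=
  GL2_of { GL2_val :> 'M[A]_2; GL2_unit : GL2_val \in unitmx }.

HB.instance Definition _ := [isSub for GL2_val].
HB.instance Definition _ := [Choice of GL2 by <:].

(* The subspace topology of M_2(A). For a field or its dual numbers inversion is
   continuous, so this is the usual topology of GL_2(A). *)
HB.instance Definition _ := Topological.copy GL2 (initial_topology GL2_val).

Definition scalar_equiv (g h : GL2) : bool :=
  `[< exists2 a : A, a \is a GRing.unit & g = a *: (h : 'M[A]_2) :> 'M[A]_2 >].

Lemma scalar_equiv_refl : reflexive scalar_equiv.
Proof. by move=> g; apply/asboolP; exists 1; rewrite ?unitr1 ?scale1r. Qed.

Lemma scalar_equiv_sym : symmetric scalar_equiv.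
Proof.
by move=> g h; apply: asbool_equiv_eq; split=> -[a ua ->];
  exists a^-1; rewrite ?unitrV// scalerA mulVr// scale1r.
Qed.

Lemma scalar_equiv_trans : transitive scalar_equiv.
Proof.
move=> h g k /asboolP[a ua gh] /asboolP[b ub hk]; apply/asboolP.
by exists (a * b); rewrite ?unitrM ?ua// gh hk scalerA.
Qed.

Canonical scalar_equiv_rel := EquivRel scalar_equiv
  scalar_equiv_refl scalar_equiv_sym scalar_equiv_trans.

(* GL_2(A) / A^*; this is PGL_2(A) when A is local. *)
Definition PGL2 : Type := quotient_topology {eq_quot scalar_equiv_rel}.
HB.instance Definition _ := Choice.on PGL2.
HB.instance Definition _ := Quotient.on PGL2.
HB.instance Definition _ := Topological.on PGL2.

Lemma PGL2_eqP (g h : GL2) :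
  \pi_PGL2 g = \pi_PGL2 h <->
  exists2 a : A, a \is a GRing.unit & g = a *: (h : 'M[A]_2) :> 'M[A]_2.
Proof.
split=> [/(@eqmodP _ scalar_equiv_rel)/asboolP //|e].
by apply/(@eqmodP _ scalar_equiv_rel)/asboolP.
Qed.

Lemma GL2_mul_unit (g h : GL2) : g *m h \in unitmx.
Proof. by rewrite unitmx_mul !GL2_unit. Qed.

Lemma GL2_inv_unit (g : GL2) : invmx g \in unitmx.
Proof. by rewrite unitmx_inv GL2_unit. Qed.

Definition GL2_one : GL2 := GL2_of (unitmx1 A 2).
Definition GL2_mul (g h : GL2) : GL2 := GL2_of (GL2_mul_unit g h).
Definition GL2_inv (g : GL2) : GL2 := GL2_of (GL2_inv_unit g).

Definition PGL2_one : PGL2 := \pi_PGL2 GL2_one.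
Definition PGL2_mul (x y : PGL2) : PGL2 := \pi_PGL2 (GL2_mul (repr x) (repr y)).
Definition PGL2_inv (x : PGL2) : PGL2 := \pi_PGL2 (GL2_inv (repr x)).

Lemma repr_PGL2 (g : GL2) :
  exists2 a : A, a \is a GRing.unit &
    repr (\pi_PGL2 g) = a *: (g : 'M[A]_2) :> 'M[A]_2.
Proof. by apply/PGL2_eqP; rewrite reprK. Qed.

Lemma PGL2_mul_pi (g h : GL2) :
  PGL2_mul (\pi_PGL2 g) (\pi_PGL2 h) = \pi_PGL2 (GL2_mul g h).
Proof.
apply/PGL2_eqP => /=.
have [a ua ->] := repr_PGL2 g; have [b ub ->] := repr_PGL2 h.
by exists (a * b); rewrite ?unitrM ?ua// -scalemxAl -scalemxAr scalerA.
Qed.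

Lemma PGL2_inv_pi (g : GL2) : PGL2_inv (\pi_PGL2 g) = \pi_PGL2 (GL2_inv g).
Proof.
apply/PGL2_eqP => /=; have [a ua ->] := repr_PGL2 g.
by exists a^-1; rewrite ?unitrV// invmxZ// unitmxZ ?GL2_unit.
Qed.

Lemma PGL2_mulA : associative PGL2_mul.
Proof.
elim/quotW=> x; elim/quotW=> y; elim/quotW=> z.
rewrite (PGL2_mul_pi y z) (PGL2_mul_pi x y) !PGL2_mul_pi.
by congr (\pi_PGL2 _); apply: val_inj; rewrite /= mulmxA.
Qed.

Lemma PGL2_mul1g : left_id PGL2_one PGL2_mul.
Proof.
elim/quotW=> x; rewrite /PGL2_one !PGL2_mul_pi.
by congr (\pi_PGL2 _); apply: val_inj; rewrite /= mul1mx.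
Qed.

Lemma PGL2_mulg1 : right_id PGL2_one PGL2_mul.
Proof.
elim/quotW=> x; rewrite /PGL2_one !PGL2_mul_pi.
by congr (\pi_PGL2 _); apply: val_inj; rewrite /= mulmx1.
Qed.

Lemma PGL2_mulVg : left_inverse PGL2_one PGL2_inv PGL2_mul.
Proof.
elim/quotW=> x; rewrite /PGL2_one PGL2_inv_pi PGL2_mul_pi.
by congr (\pi_PGL2 _); apply: val_inj; rewrite /= mulVmx ?GL2_unit.
Qed.

Lemma PGL2_mulgV : right_inverse PGL2_one PGL2_inv PGL2_mul.
Proof.
elim/quotW=> x; rewrite /PGL2_one PGL2_inv_pi PGL2_mul_pi.
by congr (\pi_PGL2 _); apply: val_inj; rewrite /= mulmxV ?GL2_unit.
Qed.

HB.instance Definition _ := isGroup.Build PGL2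
  PGL2_mulA PGL2_mul1g PGL2_mulg1 PGL2_mulVg PGL2_mulgV.

(* The class of an invertible matrix; a non-invertible one is sent to 1. *)
Definition PGL2_of (M : 'M[A]_2) : PGL2 := \pi_PGL2 (insubd GL2_one M).

Definition PGL2_mx (x : PGL2) : 'M[A]_2 := GL2_val (repr x).

End PGL2.

Section DualNumbers.
Variable F : nonarchLocalFieldType.

Definition dual_numbers : Type := {poly %/ ('X^2 : {poly F})}.
HB.instance Definition _ := GRing.ComUnitRing.on dual_numbers.

Definition dual_coefs (x : dual_numbers) : F * F :=
  ((x : {poly F})`_0, (x : {poly F})`_1).
HB.instance Definition _ :=
  Topological.copy dual_numbers (initial_topology dual_coefs).

Definition dualC (c : F) : dual_numbers := qpolyC 'X^2 c.
Definition dual_eps : dual_numbers := qpolyX 'X^2.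

Definition dual_integers : set dual_numbers :=
  [set x | integers (dual_coefs x).1 /\ integers (dual_coefs x).2].

End DualNumbers.

Section Groups.
Variable F : nonarchLocalFieldType.

Local Notation Feps := (dual_numbers F).
Local Notation G := (PGL2 F).
Local Notation Geps := (PGL2 Feps).

Definition G_to_Geps (g : G) : Geps :=
  PGL2_of (map_mx (@dualC F) (PGL2_mx g)).

Definition one_plus_eps (m' : 'M[F]_2) : Geps :=
  PGL2_of (1%:M + dual_eps F *: map_mx (@dualC F) m').

(* The image of GL_2(O_eps) in PGL_2(F_eps). *)
Definition Keps : set Geps :=
  [set \pi_Geps k | k in [set k : GL2 Feps |
     forall i j, dual_integers (k i j) /\ dual_integers (invmx k i j)]].

Definition sl2 : set 'M[F]_2 := [set m | \tr m = 0].

Definition centralizer (m : 'M[F]_2) : set G :=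
  [set g | PGL2_mx g *m m *m invmx (PGL2_mx g) = m].

Definition diag2 (A : pzSemiRingType) (a b : A) : 'M[A]_2 :=
  diag_mx (\row_i (if i == ord0 then a else b)).

(* Here x in O is the lift, not the element of the residue field. *)
Definition hecke_elt (varpi x : F) : Geps :=
  PGL2_of (diag2 (dualC varpi + dual_eps F * dualC x) 1).

Definition left_coset (g : Geps) : set Geps := [set (g * k)%g | k in Keps].

Definition double_coset (g : Geps) : set Geps :=
  [set h | exists k1 k2, [/\ Keps k1, Keps k2 & h = (k1 * g * k2)%g]].

Definition left_cosets_in (D : set Geps) : set (set Geps) :=
  [set c | (exists g, c = left_coset g) /\ c `<=` D].

Definition unit_group (varpi : F) (l : nat) : set F :=
  if l is 0%N then [set x | x != 0 /\ ordv x = 0]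
  else [set 1 + varpi ^+ l * x | x in @integers F].

(* l is the conductor of the character eta of F^*. *)
Definition is_conductor (C : pzRingType) (varpi : F) (eta : F -> C) (l : nat) :=
  let trivial_on_level k := forall x, unit_group varpi k x -> eta x = 1 in
  trivial_on_level l /\ forall k, trivial_on_level k -> (l <= k)%N.

End Groups.

Section Representations.
Variables (R : realType) (F : nonarchLocalFieldType).

Local Notation C := (R[i]).
Local Notation G := (PGL2 F).
Local Notation Geps := (PGL2 (dual_numbers F)).

Definition additive_character (psi0 : F -> C) : Prop :=
  [/\ smooth psi0, forall x, `|psi0 x| = 1 &
      forall x y, psi0 (x + y) = psi0 x * psi0 y].

Definition psi (psi0 : F -> C) (m m' : 'M[F]_2) : C := psi0 (\tr (m *m m')).

(* A character of a subgroup Z of G, as a function on G whose values outside Z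
   are irrelevant. *)
Definition character (Z : set G) (chi : G -> C) : Prop :=
  [/\ smooth_on Z chi, forall z, Z z -> chi z != 0 &
      forall z w, Z z -> Z w -> chi (z * w)%g = chi z * chi w].

Definition compact_modulo (Z S : set G) : Prop :=
  exists2 B : set G, compact B &
    S `<=` [set h | exists z b, [/\ Z z, B b & h = (z * b)%g]].

Definition Vspace (psi0 : F -> C) (m : 'M[F]_2) (chi : G -> C) :
    set (Geps -> C) :=
  [set f | [/\ smooth f,
    forall m' g, sl2 m' ->
      f (one_plus_eps m' * G_to_Geps g)%g = psi psi0 m m' * f (G_to_Geps g),
    forall z g, centralizer m z ->
      f (G_to_Geps (z * g)%g) = chi z * f (G_to_Geps g) &
    compact_modulo (centralizer m) [set g | f (G_to_Geps g) != 0]]].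

Definition Kinvariants (V : set (Geps -> C)) : set (Geps -> C) :=
  [set f | V f /\ forall k g, Keps k -> f (g * k)%g = f g].

Definition finite_dimensional (X : Type) (W : set (X -> C)) : Prop :=
  exists n (b : 'I_n -> X -> C), (forall i, W (b i)) /\
    forall f, W f -> exists c : 'I_n -> C, forall x, f x = \sum_i c i * b i x.

(* On right Keps-invariant f the value does not depend on the representatives
   [xget 1 c] of the cosets c. *)
Definition hecke (varpi x : F) (f : Geps -> C) : Geps -> C := fun g =>
  (residue_card F)%:R^-1 *
  \sum_(c \in left_cosets_in (double_coset (hecke_elt varpi x)))
    f (g * xget 1%g c)%g.

Definition eigenvalue_on (X : Type) (W : set (X -> C))
    (T : (X -> C) -> (X -> C)) (lambda : C) : Prop :=
  exists f, [/\ W f, exists x, f x != 0 & forall x, T f x = lambda * f x].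

End Representations.

Definition conjugates (C : numClosedFieldType) (z w : C) : Prop :=
  exists p : {poly rat}, [/\ irreducible_poly p,
    root (map_poly ratr p) z & root (map_poly ratr p) w].

Definition Weil_number (C : numClosedFieldType) (q : nat) (z : C) : Prop :=
  integralOver (intr : int -> C) z /\
  forall w, conjugates z w -> `|w| = sqrtC q%:R.

Definition is_root_of_unity (C : pzRingType) (z : C) : Prop :=
  exists2 n, (0 < n)%N & z ^+ n = 1.

(* Main.v *)
(** A [K_eps]-invariant [f] is determined by the function [phi M = f [M]] on
    [GL_2(F)], that is, on the vertices of the tree of [PGL_2(F)].  Put
    [A = M^-1 m M].  Invariance under [1 + eps gl_2(O)] forces [A] to be integral
    wherever [phi] is nonzero, and [T_0] becomes the adjacency operator of the tree
    on such vertices.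

    The level of a vertex is the largest [k] with [A] scalar modulo [varpi^k].  If
    [phi] is a [lambda]-eigenvector, the vertices on a branch along which the level
    decreases obey the recurrence [c_(k+2) = lambda c_(k+1) - q c_k], [c_0 = 0],
    [c_1 = 1].  The support condition bounds the level on the support of [phi].  At a
    vertex of maximal level [e], according to whether [A] modulo [varpi^(e+1)] fixes
    0, 1 or 2 of the neighbouring vertices, one gets
    [(lambda - s) c_(e+1) = k c_e] with [(s, k)] one of [(0, q + 1)], [(0, q)],
    [(+-1, q)], [(eta + eta^-1, q - 1)], where in the last case [m] is split, [chi] is
    unramified and [eta] is the value of [chi] at a uniformizer, a root of unity.

    As [s] is real with [|s| <= 2] and [|s| + k <= q + 1], this forces [lambda] to be
    real with [|lambda| <= 2 sqrt q], and the same holds after conjugating [s].  So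
    the roots of [z^2 - lambda z + q] are complex conjugate Weil numbers. *)

From HB Require Import structures.
Require Import Defs.
From mathcomp Require Import all_boot all_order all_algebra.
From mathcomp Require Import finmap.
From mathcomp Require Import all_classical all_reals all_analysis.
From mathcomp Require Import complex qpoly.
From mathcomp Require Import ring lra zify.

Set Implicit Arguments.
Unset Strict Implicit.
Unset Printing Implicit Defensive.

Import Order.TTheory GRing.Theory Num.Theory.
Local Open Scope classical_set_scope.
Local Open Scope quotient_scope.
Local Open Scope ring_scope.

(** * Chebyshev recurrences and Weil numbers *)

(** Over a commutative ring, if [l = x + y] and [q = x y], this is [(x^n - y^n) / (x - y)], a
    rescaled Chebyshev polynomial of the second kind. *)
Fixpoint cheb (A : pzRingType) (q l : A) (n : nat) : A :=
  match n with
  | 0 => 0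
  | n'.+1 => match n' with
             | 0 => 1
             | n''.+1 => l * cheb q l n' - q * cheb q l n''
             end
  end.

Arguments cheb : simpl never.

Lemma chebSS (A : pzRingType) (q l : A) n :
  cheb q l n.+2 = l * cheb q l n.+1 - q * cheb q l n.
Proof. by []. Qed.

Lemma cheb_ind2 (P : nat -> Prop) :
  P 0%N -> P 1%N -> (forall n, P n -> P n.+1 -> P n.+2) -> forall n, P n.
Proof.
move=> P0 P1 PSS n; suff: P n /\ P n.+1 by case.
by elim: n => [|n [Pn PSn]]; split=> //; apply: PSS.
Qed.

Lemma rmorph_cheb (A B : pzRingType) (f : {rmorphism A -> B}) (q l : A) n :
  f (cheb q l n) = cheb (f q) (f l) n.
Proof.
elim/cheb_ind2: n => [||n IH0 IH1]; rewrite ?rmorph0 ?rmorph1//.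
by rewrite !chebSS rmorphB !rmorphM IH0 IH1.
Qed.

(** With weight 1 for [l] and 2 for [q], [cheb q l n] is homogeneous of weight [n - 1]; the factor
    [c] on the left avoids this exponent at [n = 0]. The case [c = -1] gives the parity in [l];
    other values of [c] clear denominators. *)
Lemma cheb_scale (A : comPzRingType) (c q l : A) n :
  c * cheb (c ^+ 2 * q) (c * l) n = c ^+ n * cheb q l n.
Proof.
elim/cheb_ind2: n => [||n IH0 IH1]; first by rewrite !mulr0.
  by rewrite !mulr1.
rewrite !chebSS mulrBr.
have -> : c * (c * l * cheb (c ^+ 2 * q) (c * l) n.+1) =
  c * l * (c * cheb (c ^+ 2 * q) (c * l) n.+1) by ring.
have -> : c * (c ^+ 2 * q * cheb (c ^+ 2 * q) (c * l) n) =
  c ^+ 2 * q * (c * cheb (c ^+ 2 * q) (c * l) n) by ring.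
by rewrite IH0 IH1 !exprS; ring.
Qed.

(** For [q != 0] the recurrence also runs backwards, so two consecutive zeros would propagate down
    to [cheb q l 1 = 1]. *)
Lemma cheb_no_common_root (A : idomainType) (q l : A) n :
  q != 0 -> cheb q l n.+1 = 0 -> cheb q l n != 0.
Proof.
move=> q0; elim: n => [/eqP|n IH]; first by rewrite oner_eq0.
rewrite chebSS => e; apply/eqP => c0.
have /eqP := IH c0; apply; move/eqP: e.
by rewrite c0 mulr0 sub0r oppr_eq0 mulf_eq0 (negPf q0) => /eqP.
Qed.

(* Christoffel-Darboux: the imaginary part of [c_(k+1) c_k^*] is [Im l] times a
   sum of squares. *)
Lemma cheb_root_real (C : numClosedFieldType) (q l s k : C) e :
  0 < q -> 0 < k -> s \is Num.real ->
  (l - s) * cheb q l e.+1 = k * cheb q l e -> l \is Num.real.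
Proof.
move=> q0 k0 sr rel.
have qr : q^* = q by apply: (CrealP _); apply: gtr0_real.
have kr : k^* = k by apply: (CrealP _); apply: gtr0_real.
have sr' : s^* = s by apply: (CrealP _).
pose c := cheb q l.
(* [N] is the sum of [q^(e-j) |c_j|^2] over [1 <= j <= e]. The last clause keeps [|c_(e+1)|^2 + k N]
   from vanishing at the end. *)
have [N N0 [NE Npos]] : exists2 N : C, 0 <= N &
   c e.+1 * (c e)^* - (c e.+1)^* * c e = (l - l^*) * N /\
   (c e.+1 = 0 -> N != 0).
  rewrite {rel}; elim: e => [|n [N N0 [NE Npos]]].
    exists 0 => //; split; first by rewrite /c/= conjC0 !mulr0 subrr.
    by move=> /eqP; rewrite oner_eq0.
  exists (`|c n.+1| ^+ 2 + q * N); first by rewrite addr_ge0 ?exprn_ge0 // mulr_ge0 // ltW.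
  split.
    have -> : (l - l^*) * (`|c n.+1| ^+ 2 + q * N) =
      (l - l^*) * `|c n.+1| ^+ 2 + q * ((l - l^*) * N) by ring.
    rewrite normCK -NE /c chebSS -/c rmorphB !rmorphM /= qr.
    by ring.
  move=> _; rewrite paddr_eq0 ?exprn_ge0 ?mulr_ge0 ?(ltW q0)//.
  apply/negP => /andP[]; rewrite expf_eq0/= normr_eq0 => /eqP /Npos N0'.
  by rewrite mulf_eq0 (negPf N0') orbF gt_eqF.
apply/CrealP/eqP; rewrite eq_sym -subr_eq0.
have: (l - l^*) * (`|c e.+1| ^+ 2 + k * N) = 0.
  have rel' := congr1 Num.conj rel; rewrite !rmorphM rmorphB /= kr sr' in rel'.
  have -> : (l - l^*) * (`|c e.+1| ^+ 2 + k * N) =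
    (l - l^*) * `|c e.+1| ^+ 2 + k * ((l - l^*) * N) by ring.
  rewrite normCK -NE /c.
  have -> : (l - l^*) * (cheb q l e.+1 * (cheb q l e.+1)^*) =
    ((l - s) * cheb q l e.+1) * (cheb q l e.+1)^* -
    cheb q l e.+1 * ((l^* - s) * (cheb q l e.+1)^*) by ring.
  by rewrite rel rel'; ring.
move/eqP; rewrite mulf_eq0 => /orP[//|].
rewrite paddr_eq0 ?exprn_ge0 ?mulr_ge0 ?(ltW k0)//.
rewrite expf_eq0/= normr_eq0 => /andP[/eqP /Npos Nn0].
by rewrite mulf_eq0 gt_eqF//= (negPf Nn0).
Qed.

(** The ratio of consecutive terms stays at least [r]: if [c_(n+1) >= r c_n], then
    [c_(n+2) >= (x - r) c_(n+1) >= r c_(n+1)]. *)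
Lemma cheb_growth (R : realFieldType) (r x : R) n : 0 < r -> 2 * r < x ->
  [/\ 0 <= cheb (r ^+ 2) x n, r * cheb (r ^+ 2) x n <= cheb (r ^+ 2) x n.+1 &
      0 < cheb (r ^+ 2) x n.+1].
Proof.
move=> r0 rx; elim: n => [|n [h0 h1 h2]]; first by rewrite /= mulr0.
have h : r * cheb (r ^+ 2) x n.+1 <= cheb (r ^+ 2) x n.+2.
  by rewrite chebSS; nra.
split=> //; [exact: ltW | by nra].
Qed.

(** If [x > 2 r], the growth of [cheb] turns the relation into [r (x - s) <= k]. Then
    [2 r^2 - r s < r^2 + 1 - |s|], so [r^2 - 1 < (r - 1) |s|] and [r + 1 < |s| <= 2], contrary to
    [1 < r]. *)
Lemma cheb_root_le (R : realFieldType) (r x s k : R) e :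
  1 < r -> `|s| <= 2 -> `|s| + k <= r ^+ 2 + 1 ->
  (x - s) * cheb (r ^+ 2) x e.+1 = k * cheb (r ^+ 2) x e -> x <= 2 * r.
Proof.
move=> r1 s2 sk rel; rewrite leNgt; apply/negP => xr.
have [h0 h1 h2] := cheb_growth e (lt_trans ltr01 r1) xr.
have ss : s <= `|s| := ler_norm s.
have k0 : 0 <= k.
  rewrite leNgt; apply/negP => k0.
  have : 0 < (x - s) * cheb (r ^+ 2) x e.+1 by rewrite mulr_gt0//; lra.
  by rewrite rel; nra.
have : r * (x - s) <= k.
  rewrite -(ler_pM2r h2) -mulrA rel mulrCA; exact: ler_wpM2l.
by nra.
Qed.

(** The lower bound is the upper one at [(- x, - s)], because [cheb] is even or odd in [x]. *)
Lemma cheb_root_norm_le (R : realFieldType) (r x s k : R) e :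
  1 < r -> `|s| <= 2 -> `|s| + k <= r ^+ 2 + 1 ->
  (x - s) * cheb (r ^+ 2) x e.+1 = k * cheb (r ^+ 2) x e -> `|x| <= 2 * r.
Proof.
move=> r1 s2 sk rel; rewrite ler_norml; apply/andP; split; last first.
  exact: cheb_root_le rel.
rewrite lerNl; apply: (@cheb_root_le _ r (- x) (- s) k e); rewrite ?normrN//.
have h n : cheb (r ^+ 2) (- x) n = (-1) ^+ n.+1 * cheb (r ^+ 2) x n.
  have := cheb_scale (-1) (r ^+ 2) x n.
  rewrite sqrrN expr1n mul1r !mulN1r => /(congr1 (fun y => - y)).
  by rewrite opprK => ->; rewrite [_ ^+ n.+1]exprS mulN1r mulNr.
rewrite !h ![(-1) ^+ _.+1]exprS.
have -> : (- x - - s) * (-1 * (-1 * (-1) ^+ e) * cheb (r ^+ 2) x e.+1) =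
  - (-1) ^+ e * ((x - s) * cheb (r ^+ 2) x e.+1) by ring.
by rewrite rel; ring.
Qed.

Lemma monic_cheb (A : nzRingType) (q : A) n :
  cheb q%:P 'X n.+1 \is monic /\ size (cheb q%:P 'X n.+1) = n.+1.
Proof.
elim/cheb_ind2: n => [||n [m0 s0] [m1 s1]].
- by rewrite /cheb size_poly1 monic1.
- by rewrite chebSS /= mulr1 mulr0 subr0 size_polyX monicX.
have sX : size ('X * cheb q%:P 'X n.+2) = n.+3.
  by rewrite size_monicM ?monicX ?monic_neq0// size_polyX s1.
have lt : leq (size (- (q%:P * cheb q%:P 'X n.+1))).+1 (size ('X * cheb q%:P 'X n.+2)).
  rewrite size_polyN sX mul_polyC (leq_ltn_trans (size_scale_leq _ _))// s0.
  by rewrite ltnS leqnSn.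
rewrite chebSS size_polyDl// sX; split=> //.
by rewrite monicE lead_coefDl// -monicE rpredM// monicX.
Qed.

(** A solution [l] of [(l - s) c_(e+1) = k c_e] is a root of this polynomial; monicity is what makes
    [l] an algebraic integer. *)
Lemma monic_cheb_sub (A : nzRingType) (q s k : A) n :
  ('X - s%:P) * cheb q%:P 'X n.+1 - k%:P * cheb q%:P 'X n \is monic.
Proof.
have [m sz] := monic_cheb q n.
have [szn] : (size (cheb q%:P 'X n) <= n)%N.
  by case: n {m sz} => [|n]; rewrite ?size_poly0// (monic_cheb q n).2.
have sX : size (('X - s%:P) * cheb q%:P 'X n.+1) = n.+2.
  by rewrite size_monicM ?monicXsubC ?monic_neq0// size_XsubC sz.
rewrite monicE lead_coefDl.
  by rewrite -monicE rpredM// monicXsubC.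
rewrite size_polyN sX mul_polyC (leq_ltn_trans (size_scale_leq _ _))//.
by rewrite (leq_ltn_trans szn)// ltnS leqnSn.
Qed.

(** * Polynomials with integral coefficients *)

Section IntegralCoefficients.
Variables (B : comNzRingType) (K : fieldType) (f : {rmorphism B -> K}).

Definition integral_coefs (p : {poly K}) := forall i, integralOver f p`_i.

Lemma integral_coefsC (c : K) : integralOver f c -> integral_coefs c%:P.
Proof. by move=> ic i; rewrite coefC; case: ifP => // _; apply: mxpoly.integral0. Qed.

Lemma integral_coefsX : integral_coefs 'X.
Proof. by move=> i; rewrite coefX; apply: integral_nat. Qed.

Lemma integral_coefsB p r :
  integral_coefs p -> integral_coefs r -> integral_coefs (p - r).
Proof. by move=> ip ir i; rewrite coefB; apply: integral_sub. Qed.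

Lemma integral_coefsM p r :
  integral_coefs p -> integral_coefs r -> integral_coefs (p * r).
Proof.
move=> ip ir i; rewrite coefM.
elim/big_ind: _ => [|x y|j _]; [exact: mxpoly.integral0 | exact: integral_add |].
exact: integral_mul.
Qed.

Lemma integral_monic_root (p : {poly K}) x :
  p \is monic -> integral_coefs p -> root p x -> integralOver f x.
Proof. by move=> pm ip px; apply: (integral_root_monic pm px); apply/integral_poly. Qed.

End IntegralCoefficients.

(** * From the recurrence relation to Weil numbers *)

Section WeilNumbers.
Variable R : realType.
Local Notation C := R[i].

(** The bounds live in an ordered field, so [l] is first shown to be real and the relation is then
    read in [R], with [r] the square root of [q]. *)
Lemma cheb_root_disc (q : nat) (l s k : C) e :
  (1 < q)%N -> 0 < k -> s \is Num.real -> `|s| <= 2 -> `|s| + k <= q%:R + 1 ->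
  (l - s) * cheb q%:R l e.+1 = k * cheb q%:R l e ->
  exists2 x : R, l = (x%:C)%C & x ^+ 2 <= 4 * q%:R.
Proof.
move=> q1 k0 sr s2 sk rel.
have lr : l \is Num.real.
  by apply: cheb_root_real rel => //; rewrite ltr0n ltnW.
have toR (z : C) : z \is Num.real -> exists x : R, z = (x%:C)%C.
  by move=> /RRe_real <-; exists (complex.Re z).
have [x xE] := toR _ lr; have [s' sE] := toR _ sr.
have [k' kE] := toR _ (gtr0_real k0).
exists x => //.
pose r : R := Num.sqrt q%:R.
have r2 : r ^+ 2 = q%:R by rewrite sqr_sqrtr// ler0n.
have r1 : 1 < r.
  rewrite -(@ltr_pXn2r R 2%N) ?nnegrE ?sqrtr_ge0//.
  by rewrite r2 expr1n ltr1n.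
suff xr : `|x| <= 2 * r.
  have x0 := normr_ge0 x.
  by rewrite -real_normK ?num_real// -r2; nra.
move: s2 sk rel; rewrite xE sE kE.
have norm_real (y : R) : `|(y%:C)%C| = ((`|y|)%:C)%C.
  by rewrite normc_def /= expr0n /= addr0 sqrtr_sqr.
have natE n : n%:R = ((n%:R : R)%:C)%C :> C by rewrite rmorph_nat.
rewrite !natE -r2 norm_real -!(rmorph1 (real_complex R)) -!rmorphD /= -!rmorphB /=.
rewrite -!(rmorph_cheb (real_complex R)) -!rmorphM /= !lecR.
by move=> s2 sk /complexI; apply: cheb_root_norm_le.
Qed.

(** Let [w = a + i b]. If [b != 0], the imaginary part gives [x = 2 a] and the real part becomes
    [a^2 + b^2 = q]. A real root is a double root, since [(2 a - x)^2 = x^2 - 4 q <= 0]. *)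
Lemma Weil_disc (q : nat) (x : R) (w : C) : x ^+ 2 <= 4 * q%:R ->
  w ^+ 2 - (x%:C)%C * w + q%:R = 0 -> `|w| = sqrtC q%:R.
Proof.
move=> xq; case: w => a b.
have -> : (q%:R : C) = ((q%:R : R)%:C)%C by rewrite rmorph_nat.
rewrite expr2 => /eqP; rewrite eq_complex /= => /andP[/eqP re /eqP im].
suff ab : a ^+ 2 + b ^+ 2 = q%:R.
  by rewrite -ab (add_Re2_Im2 (Complex a b)) sqrCK.
have [b0|b0] := eqVneq b 0; last first.
  have x2 : x = 2 * a by apply: (mulIf b0); lra.
  by move: re; rewrite x2; nra.
rewrite b0 in re *; nra.
Qed.

(* The conjugates of [z] are roots of the determinant of a matrix over [int[X]],
   obtained from [(l - s) c_(e+1) = k c_e] by putting [l = X + q / X], clearing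
   denominators and replacing [s] by [S]. *)
Lemma Weil_number_cheb (q k e n : nat) (S : 'M[int]_n) (s l z : C) :
  (1 < q)%N -> (0 < k)%N ->
  (forall t : C, eigenvalue (map_mx intr S) t ->
     [/\ t \is Num.real, `|t| <= 2 & `|t| + k%:R <= q%:R + 1]) ->
  eigenvalue (map_mx intr S) s ->
  (l - s) * cheb q%:R l e.+1 = k%:R * cheb q%:R l e ->
  z ^+ 2 - l * z + q%:R = 0 -> Weil_number q z.
Proof.
move=> q1 k0 hS Ss rel zrel.
have q0 : q%:R != 0 :> C by rewrite pnatr_eq0 -lt0n ltnW.
have intS : integralOver (intr : int -> C) s.
  exists (char_poly S); first exact: char_poly_monic.
  by rewrite map_char_poly -eigenvalue_root_char.
(* With [l = x + q / x] one has [x H_j(x) = x^j c_j(l)], and [al(x) - s be(x)] is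
   [x^(e+1) ((l - s) c_(e+1) - k c_e)]. The ring is a parameter because these expressions are used
   both in [int[X]] and at points of [C]. *)
pose H (A : comPzRingType) (x : A) := cheb (q%:R * x ^+ 2) (x ^+ 2 + q%:R).
pose al (A : comPzRingType) (x : A) := (x ^+ 2 + q%:R) * H A x e.+1 - k%:R * x ^+ 2 * H A x e.
pose be (A : comPzRingType) (x : A) := x * H A x e.+1.
have rmH (A B : comPzRingType) (f : {rmorphism A -> B}) x j : f (H A x j) = H B (f x) j.
  by rewrite rmorph_cheb rmorphM rmorphD rmorphXn rmorph_nat.
have rmal (A B : comPzRingType) (f : {rmorphism A -> B}) x : f (al A x) = al B (f x).
  by rewrite rmorphB !rmorphM rmorphD rmorphXn !rmorph_nat !rmH.
have rmbe (A B : comPzRingType) (f : {rmorphism A -> B}) x : f (be A x) = be B (f x).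
  by rewrite rmorphM rmH.
have Hw (w t : C) j : w ^+ 2 + q%:R = w * t -> w * H C w j = w ^+ j * cheb q%:R t j.
  by move=> E; rewrite /H E [q%:R * _]mulrC cheb_scale.
have z0 : z != 0.
  by apply: contra_eq_neq zrel => ->; rewrite expr0n/= mulr0 subr0 add0r.
have lz : z ^+ 2 + q%:R = z * l by rewrite [z * l]mulrC; apply/eqP; rewrite -subr_eq0 -zrel; apply/eqP; ring.
have evP (w : C) : (map_poly (intr : int -> C)
    (\det ((al _ ('X : {poly int}))%:M - be _ ('X : {poly int}) *: map_mx polyC S))).[w] =
    \det ((al _ w)%:M - be _ w *: map_mx intr S).
  rewrite -/(horner_eval w _) -[LHS]/((horner_eval w \o map_poly intr) _).
  rewrite -det_map_mx; congr (\det _).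
  rewrite map_mxB map_scalar_mx map_mxZ rmal rmbe /= /horner_eval map_polyX hornerX.
  by congr (_ - _ *: _); apply/matrixP => i j; rewrite !mxE /= map_polyC hornerC.
have rootz : \det ((al _ z)%:M - be _ z *: map_mx intr S) = 0 :> C.
  apply/eqP/det0P; have /eigenvalueP[v vS v0] := Ss; exists v => //.
  rewrite mulmxBr mul_mx_scalar -scalemxAr vS scalerA -scalerBl.
  suff -> : al _ z - be _ z * s = 0 by rewrite scale0r.
  apply: (mulfI z0); rewrite mulr0 /al /be.
  have -> : z * ((z ^+ 2 + q%:R) * H C z e.+1 - k%:R * z ^+ 2 * H C z e - z * H C z e.+1 * s) =
     (z ^+ 2 + q%:R - z * s) * (z * H C z e.+1) - k%:R * z ^+ 2 * (z * H C z e) by ring.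
  rewrite !(Hw z l)// lz.
  have -> : (z * l - z * s) * (z ^+ e.+1 * cheb q%:R l e.+1) -
    k%:R * z ^+ 2 * (z ^+ e * cheb q%:R l e) =
    z ^+ e.+2 * ((l - s) * cheb q%:R l e.+1 - k%:R * cheb q%:R l e).
    by rewrite !exprS; ring.
  by rewrite rel subrr mulr0.
split.
  have intl : integralOver (intr : int -> C) l.
    apply: integral_monic_root (monic_cheb_sub q%:R s k%:R e) _ _.
      have intn m : integral_coefs (intr : {rmorphism int -> C}) (m%:R)%:P.
        by apply/integral_coefsC/integral_nat.
      have intc m : integral_coefs (intr : {rmorphism int -> C}) (cheb (q%:R)%:P 'X m).
        elim/cheb_ind2: m => [||m IH0 IH1]; [exact: (intn 0%N)|exact: (intn 1%N)|].
        by rewrite chebSS; apply: integral_coefsB; apply: integral_coefsM => //; apply: integral_coefsX.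
      apply: integral_coefsB; apply: integral_coefsM => //.
      by apply: integral_coefsB; [apply: integral_coefsX | apply: integral_coefsC].
    have chE m : (cheb (q%:R)%:P 'X m).[l] = cheb q%:R l m.
      by rewrite -/(horner_eval l _) rmorph_cheb /= /horner_eval hornerC hornerX.
    by rewrite /root !hornerE !chE rel subrr.
  apply: (@integral_monic_root _ _ _ ('X * ('X - l%:P) + (q%:R)%:P)).
  - have sX : size ('X * ('X - l%:P)) = 3%N.
      by rewrite size_monicM ?monicX ?monic_neq0 ?monicXsubC// size_polyX size_XsubC.
    rewrite monicE lead_coefDl; last by rewrite sX (leq_ltn_trans (size_polyC_leq1 _)).
    by rewrite -monicE rpredM ?monicX ?monicXsubC.
  - move=> i; rewrite coefD; apply: integral_add.
      apply: integral_coefsM; first exact: integral_coefsX.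
      by apply: integral_coefsB; [apply: integral_coefsX | apply: integral_coefsC].
    by apply/integral_coefsC/integral_nat.
  by rewrite /root !hornerE -zrel; apply/eqP; ring.
move=> w [p [irr pz pw]].
have rw : \det ((al _ w)%:M - be _ w *: map_mx intr S) = 0 :> C.
  rewrite -evP; rewrite -evP in rootz.
  set P := \det _ in rootz *.
  have ratP : map_poly ratr (map_poly (intr : int -> rat) P) = map_poly (intr : int -> C) P.
    by rewrite -map_poly_comp; apply: eq_map_poly => x /=; rewrite ratr_int.
  (* An irreducible [p] divides [P] or is coprime to it, and the common root [z] excludes the
     latter. *)
  have : p %| map_poly intr P.
    rewrite -[_ %| _]negbK -irreducible_poly_coprime//; apply/negP => cop.
    have : coprimep (map_poly (ratr : rat -> C) p) (map_poly ratr (map_poly intr P)).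
      by rewrite coprimep_map.
    by move/coprimep_root/(_ pz); rewrite ratP rootz eqxx.
  rewrite -(dvdp_map (ratr : {rmorphism rat -> C})) ratP => /dvdpP[r ->].
  by rewrite hornerM (eqP pw) mulr0.
have /eqP/det0P[v v0] := rw.
rewrite mulmxBr mul_mx_scalar -scalemxAr => /eqP; rewrite subr_eq0 => /eqP vS.
(* At [0] the matrix is the scalar [q^(e+1)], which is invertible. *)
have w0 : w != 0.
  apply: contra_neq v0 => w0; move: vS; rewrite w0 /al /be mul0r scale0r.
  rewrite expr0n/= mulr0 mul0r subr0 add0r /H.
  have -> : cheb (q%:R * 0 ^+ 2 : C) (0 ^+ 2 + q%:R) e.+1 = q%:R ^+ e.
    elim: e {rel al be rmal rmbe evP rootz rw} => // j IH.
    by rewrite chebSS IH expr0n/= mulr0 mul0r subr0 add0r exprS.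
  move/eqP; rewrite scaler_eq0 -exprS expf_eq0/= (negPf q0) => /eqP.
  by [].
pose t := w + q%:R / w.
have wt : w ^+ 2 + q%:R = w * t by rewrite /t; field.
have bE : be _ w = w ^+ e.+1 * cheb q%:R t e.+1 by rewrite /be (Hw w t).
have aE : al _ w = w ^+ e.+1 * (t * cheb q%:R t e.+1 - k%:R * cheb q%:R t e).
  apply: (mulfI w0); rewrite /al wt.
  have -> : w * (w * t * H C w e.+1 - k%:R * w ^+ 2 * H C w e) =
    w * t * (w * H C w e.+1) - k%:R * w ^+ 2 * (w * H C w e) by ring.
  by rewrite !(Hw w t)// !exprS; ring.
have c0 : cheb q%:R t e.+1 != 0.
  apply/eqP => c0; have /negP := cheb_no_common_root q0 c0; apply.
  move: vS; rewrite bE aE c0 !mulr0 scale0r sub0r => /eqP.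
  rewrite scaler_eq0 (negPf v0) orbF mulf_eq0 expf_eq0 (negPf w0) andbF /=.
  by rewrite oppr_eq0 mulf_eq0 pnatr_eq0 gtn_eqF.
have b0 : be _ w != 0 by rewrite bE mulf_neq0// expf_neq0.
(* So [w] satisfies the relation of [z] with another eigenvalue of [S] in place of [s]. This is why
   [hS] is assumed for all eigenvalues. *)
have eig : eigenvalue (map_mx intr S) (al _ w / be _ w).
  apply/eigenvalueP; exists v => //; apply: (scalerI b0).
  by rewrite -vS scalerA mulrCA divff// mulr1.
have [sr s2 sk] := hS _ eig.
have [||x tx xq] := @cheb_root_disc q t _ k%:R e q1 _ sr s2 sk; first by rewrite ltr0n.
  rewrite aE bE -mulf_div divff ?expf_neq0// mul1r mulrBl divfK//; ring.
by apply: (Weil_disc xq); rewrite -tx; rewrite mulrC -wt; ring.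
Qed.

(** The integer matrix [S] records both facts needed about [s]: its eigenvalues are algebraic
    integers, and the conjugates of [s] are among them, so that one bound covers them all. *)
Lemma Weil_sum_cheb (q k e n : nat) (S : 'M[int]_n) (s l : C) :
  (1 < q)%N -> (0 < k)%N ->
  (forall t : C, eigenvalue (map_mx intr S) t ->
     [/\ t \is Num.real, `|t| <= 2 & `|t| + k%:R <= q%:R + 1]) ->
  eigenvalue (map_mx intr S) s ->
  (l - s) * cheb q%:R l e.+1 = k%:R * cheb q%:R l e ->
  exists z : C, [/\ Weil_number q z, Weil_number q z^* & l = z + z^*].
Proof.
move=> q1 k0 hS Ss rel; have [sr s2 sk] := hS _ Ss.
have [|x lx xq] := @cheb_root_disc q l s k%:R e q1 _ sr s2 sk rel; first by rewrite ltr0n.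
pose y : R := Num.sqrt (q%:R - x ^+ 2 / 4).
have y2 : y ^+ 2 = q%:R - x ^+ 2 / 4 by rewrite sqr_sqrtr//; lra.
have qE : (q%:R : C) = ((q%:R : R)%:C)%C by rewrite rmorph_nat.
have root (b : R) : b ^+ 2 = y ^+ 2 -> let z := Complex (x / 2) b in z ^+ 2 - l * z + q%:R = 0.
  move=> b2 /=; rewrite lx qE expr2; apply/eqP; rewrite eq_complex /=; apply/andP.
  by split; apply/eqP; [move: b2; rewrite y2; nra | lra].
exists (Complex (x / 2) y); split.
- exact: (Weil_number_cheb q1 k0 hS Ss rel (root _ erefl)).
- exact: (Weil_number_cheb q1 k0 hS Ss rel (root _ (sqrrN y))).
by rewrite lx; apply/eqP; rewrite eq_complex /=; apply/andP; split; apply/eqP; lra.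
Qed.

Lemma Weil_sum_int (q k e : nat) (s : int) (l : C) :
  (1 < q)%N -> (0 < k)%N -> `|s| <= 2 -> `|s| + k%:Z <= q%:Z + 1 ->
  (l - s%:~R) * cheb q%:R l e.+1 = k%:R * cheb q%:R l e ->
  exists z : C, [/\ Weil_number q z, Weil_number q z^* & l = z + z^*].
Proof.
move=> q1 k0 s2 sk; apply: (@Weil_sum_cheb q k e 1 s%:M) => // [t|].
  rewrite map_scalar_mx => /eigenvalueP[v]; rewrite mul_mx_scalar => /eqP.
  rewrite -subr_eq0 -scalerBl scaler_eq0 => /orP[|/eqP->]; last by rewrite eqxx.
  rewrite subr_eq0 => /eqP <- _; split; first by rewrite realz.
    by rewrite -intr_norm (ler_int _ _ 2).
  by move: sk; rewrite -(ler_int C) !rmorphD /= -intr_norm.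
apply/eigenvalueP; exists (const_mx 1).
  by rewrite map_scalar_mx mul_mx_scalar.
by apply/eqP => /matrixP/(_ 0 0); rewrite !mxE => /eqP; rewrite oner_eq0.
Qed.

(** The recurrence factors as two first order ones with ratios [x] and [x^-1]. Either
    [b_(k+1) - x b_k] is a nonzero geometric sequence of ratio [x^-1], or [b] itself is geometric of
    ratio [x]; a period [n] makes the [n]-th power of the ratio equal to 1. *)
Lemma periodic_root_unity (n : nat) (b : nat -> C) (t x : C) :
  x != 0 -> t = x + x^-1 -> (forall k, b k.+2 + b k = t * b k.+1) ->
  (forall k, b (k + n)%N = b k) -> (exists k, b k != 0) -> x ^+ n = 1.
Proof.
move=> x0 tx rec per [k0 bk0].
have geom (u : nat -> C) (r : C) : (forall k, u k.+1 = r * u k) ->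
    (forall k, u (k + n)%N = u k) -> (exists k, u k != 0) -> r ^+ n = 1.
  move=> ur uper [k uk]; apply: (mulIf uk).
  have -> j : r ^+ j * u k = u (k + j)%N.
    by elim: j => [|j IH]; rewrite ?mul1r ?addn0// exprS -mulrA IH addnS ur.
  by rewrite uper mul1r.
pose c k := b k.+1 - x * b k.
have cr k : c k.+1 = x^-1 * c k.
  rewrite /c; have -> : b k.+2 = t * b k.+1 - b k by rewrite -rec addrK.
  by rewrite tx; field.
have [[k ck]|c0] := pselect (exists k, c k != 0).
  apply: invr_inj; rewrite invr1 -exprVn; apply: (geom _ _ cr); last by exists k.
  by move=> j; rewrite /c -addSn !per.
apply: (geom b) => //; last by exists k0.
move=> k; apply/eqP; rewrite -subr_eq0; apply: contrapT => /negP h.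
by apply: c0; exists k.
Qed.

(** Indices are added modulo [n + 2]. The eigenvalues are the numbers [x + x^-1] with [x^(n+2) = 1];
    for [n = 0] the two neighbours coincide and the off-diagonal entries are 2. *)
Definition cycle_adjacency (A : pzSemiRingType) (n : nat) : 'M[A]_n.+2 :=
  \matrix_(i, j) ((i == j + 1)%:R + (j == i + 1)%:R).

Lemma cycle_adjacencyE n (v : 'rV[C]_n.+2) j :
  (v *m map_mx intr (cycle_adjacency int n)) 0 j = v 0 (j + 1) + v 0 (j - 1).
Proof.
rewrite mxE; under eq_bigr do rewrite !mxE rmorphD /= !rmorph_nat mulrDr.
rewrite big_split /=; congr (_ + _).
  by rewrite (bigD1 (j + 1))//= eqxx mulr1 big1 ?addr0// => i /negPf ->; rewrite mulr0.
rewrite (bigD1 (j - 1))//= subrK eqxx mulr1 big1 ?addr0// => i ij.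
by rewrite -subr_eq eq_sym (negPf ij) mulr0.
Qed.

Lemma Weil_sum_unity (q e : nat) (x l : C) :
  (1 < q)%N -> is_root_of_unity x ->
  (l - (x + x^-1)) * cheb q%:R l e.+1 = q.-1%:R * cheb q%:R l e ->
  exists z : C, [/\ Weil_number q z, Weil_number q z^* & l = z + z^*].
Proof.
move=> q1 [[//|n'] _ xn'].
(* Doubling the exponent [n' + 1] makes the length [n + 2] of the cycle at least 2. *)
pose n := n'.*2.
have {xn'} xn : x ^+ n.+2 = 1 by rewrite /n -doubleS -mul2n mulnC exprM xn' expr1n.
apply: (@Weil_sum_cheb q q.-1 e n.+2 (cycle_adjacency int n)) => //.
- by case: q q1 => [|[]].
- move=> t /eigenvalueP[v vS v0].
  (* [y] solves [t = y + y^-1]. Read along the cycle, the eigenvector is a periodic solution of the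
     recurrence, so [y] is a root of unity; hence [t = y + y^*] is real with [|t| <= 2]. *)
  pose y := (t + sqrtC (t ^+ 2 - 4)) / 2.
  have yE : y ^+ 2 - t * y + 1 = 0.
    have := sqrtCK (t ^+ 2 - 4); rewrite /y; set r := sqrtC _ => r2.
    have -> : ((t + r) / 2) ^+ 2 - t * ((t + r) / 2) + 1 = (r ^+ 2 - t ^+ 2) / 4 + 1 by field.
    by rewrite r2; field.
  have y0 : y != 0.
    by apply: contra_eq_neq yE => ->; rewrite expr0n/= mulr0 subr0 add0r oner_neq0.
  have ty : t = y + y^-1.
    by apply: (mulIf y0); rewrite mulrDl mulVf//; apply/eqP; rewrite -subr_eq0 -oppr_eq0 -yE; apply/eqP; ring.
  have yn : y ^+ n.+2 = 1.
    apply: (@periodic_root_unity _ (fun k => v 0 (inZp k)) t) => //.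
    - move=> k; have /rowP/(_ (inZp k.+1)) := vS.
      rewrite cycle_adjacencyE [RHS]mxE => <-; congr (v _ _ + v _ _).
        by apply: val_inj; rewrite /= modnDmr modnDml addn1.
      apply/eqP; rewrite eq_sym subr_eq; apply/eqP; apply: val_inj.
      by rewrite /= modnDmr modnDml addn1.
    - by move=> k; congr (v _ _); apply: val_inj; rewrite /= modnDr.
    apply: contrapT => h; move/eqP: v0; apply; apply/rowP => j; rewrite mxE.
    by apply: contrapT => /eqP vj; apply: h; exists j; rewrite valZpK.
  have ny : `|y| = 1.
    by apply/eqP; rewrite -(@pexpr_eq1 _ _ n.+2)// -normrX yn normr1.
  have yV : y^-1 = y^* by rewrite invC_norm ny expr1n invr1 mul1r.
  have t2 : `|t| <= 2.
    by rewrite ty (le_trans (ler_normD _ _))// normfV ny invr1.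
  split=> //; first by rewrite ty yV; apply/CrealP; rewrite rmorphD /= conjCK addrC.
  rewrite (le_trans (lerD t2 (lexx _)))//.
  have -> : q%:R = q.-1%:R + 1 :> C by rewrite natr1 prednK// ltnW.
  by rewrite [leLHS]addrC -addrA -[1 + 1]/(2%:R) lexx.
apply/eigenvalueP; exists (\row_i x ^+ i).
  apply/rowP => j; rewrite cycle_adjacencyE !mxE.
  have x0 : x != 0 by apply: contra_eq_neq xn => ->; rewrite expr0n eq_sym oner_neq0.
  have xS (i : 'I_n.+2) : x ^+ (i + 1)%R = x ^+ i * x.
    by rewrite -exprSr -(expr_mod i.+1 xn) /= modnDmr addn1.
  rewrite xS mulrDl [_ * x]mulrC; congr (_ + _).
  by apply: (mulIf x0); rewrite -xS subrK mulrAC mulVf// mul1r.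
by apply/eqP => /rowP/(_ 0); rewrite !mxE expr0 => /eqP; rewrite oner_eq0.
Qed.

End WeilNumbers.

(** * Valuations *)

Section Valuation.
Variable F : nonarchLocalFieldType.
Implicit Types (x y : F) (k : int).

Lemma ordv1 : ordv (1 : F) = 0.
Proof.
have o := oner_neq0 F : (1 : F) != 0; have := ordvM _ _ o o; rewrite mulr1 => /eqP.
by rewrite -subr_eq0 opprD addrA subrr sub0r oppr_eq0 => /eqP.
Qed.

Lemma ordvN x : ordv (- x) = ordv x.
Proof.
have [->|x0] := eqVneq x 0; first by rewrite oppr0.
have N1 : ordv (-1 : F) = 0.
  have n0 : (-1 : F) != 0 by rewrite oppr_eq0 oner_neq0.
  by have := ordvM _ _ n0 n0; rewrite mulrNN mulr1 ordv1; lia.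
by rewrite -mulN1r ordvM ?oppr_eq0 ?oner_neq0// N1 add0r.
Qed.

Lemma ordvV x : x != 0 -> ordv x^-1 = - ordv x.
Proof.
move=> x0; have := ordvM _ _ x0 (invr_neq0 x0).
by rewrite mulfV// ordv1; lia.
Qed.

(* [0] is added separately, because [ordv 0] is a junk value. *)
Definition fideal k : {pred F} := [pred x | (x == 0) || (k <= ordv x)].

Lemma in_fideal k x : (x \in fideal k) = (x == 0) || (k <= ordv x).
Proof. by []. Qed.

Lemma fideal_zmod_closed k : zmod_closed (fideal k).
Proof.
split=> [|x y]; first by rewrite in_fideal eqxx.
rewrite !in_fideal; have [-> _|x0 /= kx] := eqVneq x 0.
  by rewrite sub0r oppr_eq0 ordvN.
have [-> _|y0 /= ky] := eqVneq y 0; first by rewrite subr0 kx orbT.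
have [//|xy0 /=] := eqVneq (x - y) 0.
apply: le_trans (ordvD _ _ x0 _ xy0); last by rewrite oppr_eq0.
by rewrite le_min kx ordvN.
Qed.

HB.instance Definition _ k :=
  GRing.isZmodClosed.Build F (fideal k) (fideal_zmod_closed k).

Lemma fidealM j k x y : x \in fideal j -> y \in fideal k -> x * y \in fideal (j + k).
Proof.
rewrite !in_fideal mulf_eq0.
have [//|x0 /= jx] := eqVneq x 0; have [//|y0 /= ky] := eqVneq y 0.
by rewrite ordvM// lerD.
Qed.

Lemma fidealW j k x : j <= k -> x \in fideal k -> x \in fideal j.
Proof.
by move=> jk; rewrite !in_fideal => /orP[->//|h]; rewrite (le_trans jk h) orbT.
Qed.

Definition oint : {pred F} := fideal 0.

Lemma oint_subring_closed : subring_closed oint.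
Proof.
split=> [|x y|x y]; first by rewrite in_fideal ordv1 lexx orbT.
  exact: (fideal_zmod_closed 0).2.
exact: (@fidealM 0 0).
Qed.

HB.instance Definition _ := GRing.isSubringClosed.Build F oint oint_subring_closed.

Lemma fidealMl k x y : x \in oint -> y \in fideal k -> x * y \in fideal k.
Proof. by move=> hx hy; rewrite -[k]add0r; apply: fidealM. Qed.

Lemma fidealMr k x y : x \in fideal k -> y \in oint -> x * y \in fideal k.
Proof. by move=> hx hy; rewrite mulrC; apply: fidealMl. Qed.

Lemma integersP x : integers x <-> x \in oint.
Proof. by rewrite in_fideal; split=> [[->|->]|/orP[/eqP|]]; rewrite ?eqxx ?orbT//; [left|right]. Qed.

Lemma maximal_idealP x : maximal_ideal x <-> x \in fideal 1.
Proof. by rewrite in_fideal; split=> [[->|->]|/orP[/eqP|]]; rewrite ?eqxx ?orbT//; [left|right]. Qed.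

Lemma fidealVM k x y : y != 0 -> (x / y \in fideal k) = (x \in fideal (k + ordv y)).
Proof.
move=> y0; rewrite !in_fideal mulf_eq0 invr_eq0 (negPf y0) orbF.
have [//|x0 /=] := eqVneq x 0.
by rewrite ordvM ?invr_neq0// ordvV//; lia.
Qed.

Lemma ordv_eqP k x : x \in fideal k -> x \notin fideal (k + 1) -> x != 0 /\ ordv x = k.
Proof. by rewrite !in_fideal => /orP[/eqP->|h]; rewrite ?eqxx// negb_or => /andP[-> h']; split => //; lia. Qed.

Lemma bigcap_fideal x : (forall k, x \in fideal k) -> x = 0.
Proof. by move/(_ (ordv x + 1)); rewrite in_fideal => /orP[/eqP//|]; lia. Qed.

Lemma uniformizer_ordv (p : F) : uniformizer p -> p != 0 /\ ordv p = 1.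
Proof.
move=> pE; have [u u0 u1] := ordv_surj (s := F) 1.
have : maximal_ideal u by right; rewrite u1.
rewrite pE => -[x xi xu]; have [p0|p0] := eqVneq p 0.
  by move: u0; rewrite -xu p0 mul0r eqxx.
have x0 : x != 0 by apply: contraNneq u0 => x0; rewrite -xu x0 mulr0.
split => //; have : maximal_ideal p.
  by rewrite pE; exists 1; rewrite ?mulr1//; right; rewrite ordv1.
case=> [/eqP|h]; first by rewrite (negPf p0).
case: xi => [/eqP|h2]; first by rewrite (negPf x0).
by move: u1; rewrite -xu ordvM//; lia.
Qed.

(** The [r i] will index the children of a vertex and the Hecke cosets. The classes of [0] and [1]
    differ, whence the lower bound. *)
Lemma residue_reps : (1 < residue_card F)%N /\
  exists r : 'I_(residue_card F) -> F,
    [/\ forall i, r i \in oint,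
        forall x, x \in oint -> exists i, x - r i \in fideal 1 &
        forall i j, r i - r j \in fideal 1 -> i = j].
Proof.
pose cl x : set F := [set y | maximal_ideal (y - x)].
have clP x y : cl x = cl y <-> x - y \in fideal 1.
  split=> [xy|xy].
    suff : cl y x by move/maximal_idealP.
    by rewrite -xy; apply/maximal_idealP; rewrite subrr rpred0.
  apply/seteqP; split=> z /maximal_idealP h; apply/maximal_idealP.
    by have -> : z - y = (z - x) + (x - y) by [ring]; rewrite rpredD.
  by have -> : z - x = (z - y) - (x - y) by [ring]; rewrite rpredB.
have finR : finite_set (@residue_field F).
  have [s hs] := residue_finite (s := F).
  apply: (@sub_finite_set _ _ (cl @` [set` s])); last exact: finite_image.
  move=> _ [x xi <-]; have [y ys xy] := hs x xi; exists y => //.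
  apply/esym/clP; case: xy => [->|xy]; rewrite ?subrr ?rpred0// in_fideal xy.
  by rewrite orbT.
pose E := enum_fset (fset_set (@residue_field F)).
have memE c : (c \in E) = `[< @residue_field F c >].
  by rewrite in_fset_set// inE.
have clE x : x \in oint -> cl x \in E.
  by move=> /integersP xo; rewrite memE; apply/asboolP; exists x.
split.
  rewrite /residue_card -/E; have [] := (clE 0 (rpred0 _), clE 1 (rpred1 _)).
  case: E {memE clE} => [|c [|d s]]//; rewrite !mem_seq1 => /eqP <- /eqP/clP.
  by rewrite subr0 in_fideal oner_eq0 ordv1.
have /choice[r hr] (i : 'I_(residue_card F)) :
    exists x, x \in oint /\ cl x = nth set0 E i.
  have : nth set0 E i \in E by rewrite mem_nth.
  by rewrite memE => /asboolP[x /integersP xo xE]; exists x.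
exists r; split=> [i|x xo|i j /clP]; first exact: (hr i).1.
  have xE := clE _ xo; have lt : (index (cl x) E < residue_card F)%N.
    by rewrite index_mem.
  by exists (Ordinal lt); apply/clP; rewrite (hr _).2 /= nth_index.
rewrite !(hr _).2 => /eqP; rewrite nth_uniq//; last exact: fset_uniq.
by move=> /eqP/val_inj.
Qed.

(* Hensel: the iteration [t |-> b + g t^2] is a contraction on the integers. *)
Lemma quadratic_fixpoint (b g : F) : b \in oint -> g \in fideal 1 ->
  exists2 t, t \in oint & t = b + g * t ^+ 2.
Proof.
move=> bo g1; pose u n := iter n (fun t => b + g * t ^+ 2) 0.
have go : g \in oint by apply: fidealW g1.
have uo n : u n \in oint.
  by elim: n => [|n IH]; rewrite /u /= ?rpred0// rpredD// rpredM// rpredX.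
have uS n : u n.+1 - u n \in fideal n%:Z.
  elim: n => [|n IH]; first exact: rpredB.
  have -> : u n.+2 - u n.+1 = g * ((u n.+1 - u n) * (u n.+1 + u n)).
    by rewrite /u /=; ring.
  rewrite -[n.+1]add1n PoszD; apply: fidealM => //.
  by apply: fidealMr => //; apply: rpredD.
have uC n m : (n <= m)%N -> u m - u n \in fideal n%:Z.
  move=> /subnK <-; elim: (m - n)%N => [|k IH]; first by rewrite subrr rpred0.
  have -> : u (k.+1 + n)%N - u n = (u (k.+1 + n)%N - u (k + n)%N) + (u (k + n)%N - u n) by ring.
  by apply: rpredD => //; apply: fidealW (uS (k + n)%N); rewrite lez_nat leq_addl.
have : cauchy (u @ \oo).
  move=> A; rewrite entourage_ordvE => -[N _ hN].
  exists ([set x | exists2 n, (`|N| <= n)%N & x = u n],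
          [set x | exists2 n, (`|N| <= n)%N & x = u n]) => /=.
    by split; exists `|N|%N => // n /= Nn; exists n.
  move=> [_ _] [/= [n Nn ->] [m Nm ->]]; apply: hN => /=.
  have : u n - u m \in fideal N.
    have hf j : (`|N| <= j)%N -> u j - u `|N|%N \in fideal N.
      by move=> /uC; apply: fidealW; lia.
    have -> : u n - u m = (u n - u `|N|%N) - (u m - u `|N|%N) by ring.
    by rewrite rpredB// hf.
  by rewrite in_fideal subr_eq0 => /orP[/eqP|]; [left|right].
move=> /cauchy_converges [t ut].
have ht (k : nat) : exists2 n, (k <= n)%N & t - u n \in fideal k%:Z.
  have : nbhs t [set x | t - x \in fideal k%:Z].
    rewrite -nbhs_entourageE; exists [set xy | xy.1 = xy.2 \/ k%:Z <= ordv (xy.1 - xy.2)].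
      by rewrite entourage_ordvE; exists k%:Z.
    move=> x /xsectionP /= [->|h]; first by rewrite subrr rpred0.
    by rewrite in_fideal h orbT.
  move=> /ut [M _ hM]; exists (maxn k M); rewrite ?leq_maxl//.
  by apply: hM => /=; rewrite leq_maxr.
have to : t \in oint.
  have [n _] := ht 0%N => h; rewrite -[t](subrK (u n)); apply: rpredD => //.
exists t => //; apply/eqP; rewrite -subr_eq0; apply/eqP/bigcap_fideal => k.
have [n kn tn] := ht `|k|%N; apply: (@fidealW k `|k|%N); first by lia.
have -> : t - (b + g * t ^+ 2) = (t - u n) - (u n.+1 - u n) - g * ((t - u n) * (t + u n)).
  by rewrite /u /=; ring.
apply: rpredB; last by apply: fidealMl => //; apply: fidealMr => //; apply: rpredD.
apply: rpredB => //; apply: fidealW (uS n).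
by rewrite lez_nat.
Qed.

End Valuation.

(** * Two by two matrices and dual numbers *)

Definition mx2 (A : Type) (a b c d : A) : 'M[A]_2 :=
  \matrix_(i, j) if i == 0 then (if j == 0 then a else b)
                 else (if j == 0 then c else d).

Lemma mx2P (A : Type) (M N : 'M[A]_2) :
  M 0 0 = N 0 0 -> M 0 1 = N 0 1 -> M 1 0 = N 1 0 -> M 1 1 = N 1 1 -> M = N.
Proof.
move=> h00 h01 h10 h11; apply/matrixP => i j.
have ord2 (k : 'I_2) : k = 0 \/ k = 1.
  by case: k => [[|[|k]] lt]//; [left|right]; apply: val_inj.
by case: (ord2 i) => ->; case: (ord2 j) => ->.
Qed.

Lemma mx2_eta (A : Type) (M : 'M[A]_2) : M = mx2 (M 0 0) (M 0 1) (M 1 0) (M 1 1).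
Proof. by apply: mx2P; rewrite mxE. Qed.

Lemma map_mx2 (A B : Type) (f : A -> B) a b c d :
  map_mx f (mx2 a b c d) = mx2 (f a) (f b) (f c) (f d).
Proof. by apply: mx2P; rewrite !mxE. Qed.

Section Mx2Ring.
Variable A : pzRingType.
Implicit Types a b c d x : A.

Lemma mx2M a b c d a' b' c' d' : mx2 a b c d *m mx2 a' b' c' d' =
  mx2 (a * a' + b * c') (a * b' + b * d') (c * a' + d * c') (c * b' + d * d').
Proof. by apply: mx2P; rewrite !mxE !big_ord_recl big_ord0 addr0 !mxE. Qed.

Lemma mx2D a b c d a' b' c' d' :
  mx2 a b c d + mx2 a' b' c' d' = mx2 (a + a') (b + b') (c + c') (d + d').
Proof. by apply: mx2P; rewrite !mxE. Qed.

Lemma mx2Z x a b c d : x *: mx2 a b c d = mx2 (x * a) (x * b) (x * c) (x * d).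
Proof. by apply: mx2P; rewrite !mxE. Qed.

Lemma mx2_1 : 1%:M = mx2 1 0 0 1 :> 'M[A]_2.
Proof. by apply: mx2P; rewrite !mxE. Qed.

Lemma diag2E a d : diag2 a d = mx2 a 0 0 d.
Proof. by apply: mx2P; rewrite !mxE. Qed.

Lemma mx2_tr a b c d : \tr (mx2 a b c d) = a + d.
Proof. by rewrite /mxtrace !big_ord_recl big_ord0 addr0 !mxE. Qed.

Lemma mx2_mxOver (S : {pred A}) a b c d :
  a \in S -> b \in S -> c \in S -> d \in S -> mx2 a b c d \is a mxOver S.
Proof. by move=> *; apply/mxOverP => i j; rewrite mxE; do 2!case: ifP. Qed.

End Mx2Ring.

Lemma invmx_eq (A : comUnitRingType) n (X Y : 'M[A]_n) :
  X *m Y = 1%:M -> X \in unitmx /\ invmx X = Y.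
Proof.
move=> XY; have [Xu _] := mulmx1_unit XY; split=> //.
by rewrite -[Y](mulKmx Xu) XY mulmx1.
Qed.

Section PGL2Matrices.
Variable A : topComUnitRingType.
Implicit Types X Y : 'M[A]_2.

Lemma PGL2_of_GL2 (g : GL2 A) : PGL2_of (g : 'M[A]_2) = \pi_(PGL2 A) g.
Proof. by rewrite /PGL2_of; congr (\pi _); apply: val_inj; rewrite val_insubd /= GL2_unit. Qed.

Lemma PGL2_ofM X Y : X \in unitmx -> Y \in unitmx ->
  PGL2_of (X *m Y) = (PGL2_of X * PGL2_of Y)%g.
Proof.
move=> uX uY; rewrite -[X]/(GL2_val (GL2_of uX)) -[Y]/(GL2_val (GL2_of uY)).
rewrite -[_ *m _]/(GL2_val (GL2_mul (GL2_of uX) (GL2_of uY))).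
by rewrite !PGL2_of_GL2; apply/esym/PGL2_mul_pi.
Qed.

Lemma PGL2_of1 : PGL2_of 1%:M = 1%g :> PGL2 A.
Proof. by rewrite -[1%:M]/(GL2_val (GL2_one A)) PGL2_of_GL2. Qed.

Lemma PGL2_of_eqP X Y : X \in unitmx -> Y \in unitmx ->
  PGL2_of X = PGL2_of Y <-> exists2 a, a \is a GRing.unit & X = a *: Y.
Proof.
move=> uX uY; rewrite -[X]/(GL2_val (GL2_of uX)) -[Y]/(GL2_val (GL2_of uY)).
by rewrite !PGL2_of_GL2; apply: PGL2_eqP.
Qed.

Lemma PGL2_mx_unit (g : PGL2 A) : PGL2_mx g \in unitmx.
Proof. exact: GL2_unit. Qed.

Lemma PGL2_mxK (g : PGL2 A) : PGL2_of (PGL2_mx g) = g.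
Proof. by rewrite PGL2_of_GL2 reprK. Qed.

Lemma PGL2_mx_of X : X \in unitmx ->
  exists2 a, a \is a GRing.unit & PGL2_mx (PGL2_of X) = a *: X.
Proof. by move=> uX; apply/PGL2_of_eqP; rewrite ?PGL2_mx_unit// PGL2_mxK. Qed.

End PGL2Matrices.

(* Otherwise unification unfolds both sides of products in [PGL2]. *)
#[global] Opaque PGL2_of PGL2_mul PGL2_inv.

(** * Coordinates on the dual numbers and the group [Keps] *)

Section DualNumberTheory.
Variable F : nonarchLocalFieldType.
Local Notation D := (dual_numbers F).
Implicit Types x y : D.

Definition dual0 (x : D) : F := (dual_coefs x).1.
Definition dual1 (x : D) : F := (dual_coefs x).2.
Definition dual (a b : F) : D := dualC a + dual_eps F * dualC b.

Lemma dual_ext x y : dual0 x = dual0 y -> dual1 x = dual1 y -> x = y.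
Proof.
move=> e0 e1; apply/npolyP => i; case: i => [|[|i]] //.
by rewrite !big_coef_npoly// mk_monic_Xn size_polyXn.
Qed.

(** Reduction modulo ['X^2] does not change the coefficients of degree 0 and 1. *)
Lemma coef_dualM x y i : (i < 2)%N ->
  (x * y : {poly F})`_i = ((x : {poly F}) * (y : {poly F}))`_i.
Proof.
move=> i2; rewrite poly_of_qpolyM.
suff gen (p : {poly F}) : (Pdiv.Ring.rmodp p (mk_monic 'X^2))`_i = p`_i by apply: gen.
have m : ('X^2 : {poly F}) \is monic by apply: monicXn.
rewrite mk_monic_Xn /= [in RHS](Pdiv.RingMonic.rdivp_eq m p) coefD coefMXn i2.
by rewrite add0r.
Qed.

Lemma dual0M x y : dual0 (x * y) = dual0 x * dual0 y.
Proof. by rewrite /dual0 /= coef_dualM// coefM big_ord_recl big_ord0 addr0. Qed.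

Lemma dual1M x y : dual1 (x * y) = dual0 x * dual1 y + dual1 x * dual0 y.
Proof.
by rewrite /dual1 /= coef_dualM// coefM !big_ord_recl big_ord0 addr0.
Qed.

Lemma dual0B : {morph dual0 : x y / x - y}.
Proof. by move=> x y; rewrite /dual0 /= coefB. Qed.

Lemma dual1B : {morph dual1 : x y / x - y}.
Proof. by move=> x y; rewrite /dual1 /= coefB. Qed.

HB.instance Definition _ := GRing.isZmodMorphism.Build D F dual0 dual0B.
HB.instance Definition _ := GRing.isZmodMorphism.Build D F dual1 dual1B.

Lemma dual0C a : dual0 (dualC a) = a.
Proof. by rewrite /dual0 /= coefC. Qed.

Lemma dual1C a : dual1 (dualC a) = 0.
Proof. by rewrite /dual1 /= coefC. Qed.

Lemma dual0_1 : dual0 1 = 1. Proof. exact: dual0C. Qed.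
Lemma dual1_1 : dual1 1 = 0. Proof. exact: dual1C. Qed.

HB.instance Definition _ := GRing.isMonoidMorphism.Build D F dual0 (dual0_1, dual0M).
HB.instance Definition _ := GRing.RMorphism.copy (@dualC F) (qpolyC 'X^2).

Lemma dual_epsE : (dual_eps F : {poly F}) = 'X.
Proof. by rewrite /dual_eps qpolyXE ?size_polyXn ?monicXn. Qed.

Lemma dual0_eps : dual0 (dual_eps F) = 0.
Proof. by rewrite /dual0 /dual_coefs dual_epsE coefX. Qed.

Lemma dual1_eps : dual1 (dual_eps F) = 1.
Proof. by rewrite /dual1 /dual_coefs dual_epsE !coefX. Qed.

Lemma dual0E a b : dual0 (dual a b) = a.
Proof. by rewrite /dual rmorphD rmorphM /= dual0_eps !dual0C mul0r addr0. Qed.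

Lemma dual1E a b : dual1 (dual a b) = b.
Proof. by rewrite /dual raddfD /= dual1M dual0_eps dual1_eps dual0C !dual1C mul0r !add0r mul1r. Qed.

Lemma dual_unit x : (x \is a GRing.unit) = (dual0 x != 0).
Proof.
apply/idP/idP => [/mulrV/(congr1 dual0)|x0].
  rewrite rmorphM rmorph1 /=; apply: contra_eq_neq => ->.
  by rewrite mul0r eq_sym oner_neq0.
apply/unitrPr; exists (dual (dual0 x)^-1 (- dual1 x / dual0 x ^+ 2)).
apply: dual_ext; rewrite ?dual0M ?dual1M !dual0E ?dual1E ?dual0_1 ?dual1_1.
  exact: mulfV.
by field.
Qed.

Definition dint : {pred D} := [pred x | (dual0 x \in @oint F) && (dual1 x \in @oint F)].

Lemma in_dint x : (x \in dint) = (dual0 x \in @oint F) && (dual1 x \in @oint F).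
Proof. by []. Qed.

Lemma dint_subring_closed : subring_closed dint.
Proof.
split=> [|x y|x y]; rewrite !in_dint ?dual0_1 ?dual1_1 ?rpred1 ?rpred0//.
  by move=> /andP[x0 x1] /andP[y0 y1]; rewrite !raddfB !rpredB.
by move=> /andP[x0 x1] /andP[y0 y1]; rewrite dual0M dual1M rpredD ?rpredM.
Qed.

HB.instance Definition _ := GRing.isSubringClosed.Build D dint dint_subring_closed.

Lemma dual_integersP x : dual_integers x <-> x \in dint.
Proof.
rewrite in_dint; split=> [[/integersP h0 /integersP h1]|/andP[h0 h1]]; first exact/andP.
by split; apply/integersP.
Qed.

Lemma dualC_dint a : a \in @oint F -> dualC a \in dint.
Proof. by move=> ao; rewrite in_dint dual0C dual1C ao rpred0. Qed.

Lemma dual_dint a b : a \in @oint F -> b \in @oint F -> dual a b \in dint.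
Proof. by move=> ao bo; rewrite in_dint dual0E dual1E ao. Qed.

Lemma KepsP (k : PGL2 D) : Keps k <-> exists X Y, [/\ X *m Y = 1%:M,
  X \is a mxOver dint, Y \is a mxOver dint & k = PGL2_of X].
Proof.
split=> [[g gi <-]|[X [Y [XY Xi Yi ->]]]].
  exists (GL2_val g), (invmx (GL2_val g)).
  split; rewrite ?mulmxV ?GL2_unit ?PGL2_of_GL2//; apply/mxOverP => i j;
  by have [/dual_integersP ? /dual_integersP ?] := gi i j.
have [uX XV] := invmx_eq XY.
exists (GL2_of uX); last by rewrite -PGL2_of_GL2.
by move=> i j /=; rewrite XV; split; apply/dual_integersP; apply/mxOverP.
Qed.

Lemma Keps1 : Keps (1%g : PGL2 D).
Proof.
apply/KepsP; exists 1%:M, 1%:M; rewrite mulmx1 PGL2_of1; split=> //;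
  by rewrite mx2_1 mx2_mxOver ?rpred1 ?rpred0.
Qed.

Lemma KepsM (k l : PGL2 D) : Keps k -> Keps l -> Keps (k * l)%g.
Proof.
move=> /KepsP[X [Y [XY Xi Yi ->]]] /KepsP[X' [Y' [XY' Xi' Yi' ->]]].
have [uX _] := invmx_eq XY; have [uX' _] := invmx_eq XY'.
apply/KepsP; exists (X *m X'), (Y' *m Y); rewrite PGL2_ofM// !mxOverM//.
by rewrite mulmxA -(mulmxA X) XY' mulmx1.
Qed.

Lemma KepsV (k : PGL2 D) : Keps k -> Keps k^-1%g.
Proof.
move=> /KepsP[X [Y [XY Xi Yi ->]]]; have YX := mulmx1C XY.
have [uX _] := invmx_eq XY; have [uY _] := invmx_eq YX.
apply/KepsP; exists Y, X; split=> //.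
by apply: (mulgI (PGL2_of X)); rewrite mulgV -PGL2_ofM// XY PGL2_of1.
Qed.

End DualNumberTheory.

(** * The decomposition of [PGL_2(F_eps)] into [1 + eps sl_2(F)] and [PGL_2(F)] *)

Section Embedding.
Variable F : nonarchLocalFieldType.
Local Notation D := (dual_numbers F).
Local Notation eps := (dual_eps F).
Implicit Types M N : 'M[F]_2.

(** Unlike [G_to_Geps], this starts from a matrix and not from its class, which keeps chosen
    representatives out of the computations. *)
Definition emb (M : 'M[F]_2) : PGL2 D := PGL2_of (map_mx (@dualC F) M).

Lemma unitmx_dualC M : M \in unitmx -> map_mx (@dualC F) M \in unitmx.
Proof.
move=> uM; apply: (@invmx_eq _ _ _ (map_mx (@dualC F) (invmx M)) _).1.
by rewrite -map_mxM mulmxV// map_mx1.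
Qed.

Lemma embM M N : M \in unitmx -> N \in unitmx -> emb (M *m N) = (emb M * emb N)%g.
Proof. by move=> uM uN; rewrite /emb map_mxM PGL2_ofM ?unitmx_dualC. Qed.

Lemma embZ a M : a != 0 -> M \in unitmx -> emb (a *: M) = emb M.
Proof.
move=> a0 uM; apply/PGL2_of_eqP; rewrite ?unitmx_dualC ?unitmxZ ?unitfE//.
by exists (dualC a); rewrite ?map_mxZ// dual_unit dual0C.
Qed.

Lemma G_to_Geps_emb M : M \in unitmx -> G_to_Geps (PGL2_of M) = emb M.
Proof.
move=> uM; rewrite /G_to_Geps; have [a ua ->] := PGL2_mx_of uM.
by apply: embZ => //; rewrite -unitfE.
Qed.

Lemma eps2 : eps * eps = 0.
Proof. by apply: dual_ext; rewrite ?dual0M ?dual1M !dual0_eps ?raddf0 ?mul0r ?mulr0 ?addr0. Qed.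

Lemma one_plus_epsM N N' :
  (1%:M + eps *: map_mx (@dualC F) N) *m (1%:M + eps *: map_mx (@dualC F) N') =
  1%:M + eps *: map_mx (@dualC F) (N + N').
Proof.
rewrite mulmxDl mul1mx mulmxDr mulmx1 -scalemxAl -scalemxAr scalerA eps2 scale0r addr0.
by rewrite map_mxD scalerDr -addrA [eps *: _ + _]addrC.
Qed.

Lemma one_plus_eps_unit N : 1%:M + eps *: map_mx (@dualC F) N \in unitmx.
Proof.
apply: (@invmx_eq _ _ _ (1%:M + eps *: map_mx (@dualC F) (- N)) _).1.
by rewrite one_plus_epsM subrr map_mx0 scaler0 addr0.
Qed.

Lemma emb_one_plus_eps M N : M \in unitmx ->
  (emb M * one_plus_eps N)%g = (one_plus_eps (M *m N *m invmx M) * emb M)%g.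
Proof.
move=> uM; have E1 := PGL2_ofM (unitmx_dualC uM) (one_plus_eps_unit N).
have E2 := PGL2_ofM (one_plus_eps_unit (M *m N *m invmx M)) (unitmx_dualC uM).
apply: (etrans (esym E1)); apply: (etrans _ E2); apply: (congr1 (@PGL2_of _)).
rewrite mulmxDr mulmxDl mulmx1 mul1mx -scalemxAr -scalemxAl.
by rewrite -map_mxM -map_mxM mulmxKV.
Qed.

Lemma emb_one_plus_eps_emb M N H : M \in unitmx -> H \in unitmx ->
  (emb M * one_plus_eps N * emb H)%g =
  (one_plus_eps (M *m N *m invmx M) * emb (M *m H))%g.
Proof.
move=> uM uH; apply: etrans (congr1 (fun x => x * emb H)%g (emb_one_plus_eps N uM)) _.
apply: etrans (esym (mulgA _ _ _)) _.
exact: (congr2 (fun x y => x * y)%g erefl (esym (embM uM uH))).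
Qed.

(** A matrix [M + eps X1] equals [(1 + eps N) M] with [N = X1 M^-1]. Dividing by the scalar
    [1 + eps t], trivial in [PGL2], with [t] half the trace of [N] makes [N] traceless. *)
Lemma one_plus_eps_decomposition (x : PGL2 D) : 2 != 0 :> F ->
  exists n M, [/\ sl2 n, M \in unitmx & x = (one_plus_eps n * emb M)%g].
Proof.
move=> two; pose X := PGL2_mx x; have uX : X \in unitmx := PGL2_mx_unit x.
pose M := map_mx (@dual0 F) X; pose X1 := map_mx (@dual1 F) X.
have XE : X = map_mx (@dualC F) M + eps *: map_mx (@dualC F) X1.
  by apply/matrixP => i j; rewrite !mxE; apply: dual_ext; rewrite ?dual0E ?dual1E.
have uM : M \in unitmx.
  apply: (@invmx_eq _ _ _ (map_mx (@dual0 F) (invmx X)) _).1.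
  by rewrite -map_mxM mulmxV// map_mx1.
pose N := X1 *m invmx M; pose t := \tr N / 2.
exists (N - t%:M), M; split => //.
  by rewrite /sl2 /= raddfB /= mxtrace_scalar /t; apply/eqP; rewrite subr_eq0 -[_ *+ 2]mulr_natr divfK.
rewrite /one_plus_eps /emb -(PGL2_ofM (one_plus_eps_unit _) (unitmx_dualC uM)).
rewrite -[LHS]PGL2_mxK -/X; apply/PGL2_of_eqP => //.
  by rewrite unitmx_mul one_plus_eps_unit unitmx_dualC.
exists (dual 1 t); first by rewrite dual_unit dual0E oner_neq0.
have tS : map_mx (@dualC F) (@scalar_mx F 2 t) = (dualC t)%:M by apply/matrixP => i j; rewrite !mxE rmorphMn.
rewrite map_mxD map_mxN tS mulmxDl mul1mx -scalemxAl mulmxBl -map_mxM mulmxKV// mul_scalar_mx.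
rewrite XE; move: (map_mx _ M) (map_mx _ X1) => Y Z; rewrite /dual.
have -> : dualC 1 = 1 :> D by apply: rmorph1.
rewrite scalerDl scale1r [(eps * _) *: _]scalerDr [(eps * _) *: (eps *: _)]scalerA mulrAC eps2.
by rewrite mul0r scale0r addr0 scalerBr scalerA -addrA subrK.
Qed.

Lemma one_plus_eps_scalar N t : one_plus_eps (N + t%:M) = one_plus_eps N.
Proof.
apply/PGL2_of_eqP; rewrite ?one_plus_eps_unit//.
exists (dual 1 t); first by rewrite dual_unit dual0E oner_neq0.
have tS : map_mx (@dualC F) (@scalar_mx F 2 t) = (dualC t)%:M.
  by apply/matrixP => i j; rewrite !mxE rmorphMn.
rewrite map_mxD tS; move: (map_mx _ N) => Y; rewrite /dual.
have -> : dualC 1 = 1 :> D by apply: rmorph1.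
rewrite scalerDl scale1r scalerDr [(eps * _) *: _]scalerDr [(eps * _) *: (eps *: _)]scalerA mulrAC eps2.
by rewrite mul0r scale0r addr0 !scale_scalar_mx mulr1 addrA.
Qed.

Lemma Keps_emb M N : M *m N = 1%:M -> M \is a mxOver (@oint F) ->
  N \is a mxOver (@oint F) -> Keps (emb M).
Proof.
move=> MN /mxOverP Mi /mxOverP Ni; apply/KepsP.
exists (map_mx (@dualC F) M), (map_mx (@dualC F) N).
rewrite -map_mxM MN map_mx1; split=> //; apply/mxOverP => i j; rewrite mxE;
  exact: dualC_dint.
Qed.

Lemma Keps_mx2 (a b c d e : D) : a \in @dint F -> b \in @dint F -> c \in @dint F ->
  d \in @dint F -> e \in @dint F -> (a * d - b * c) * e = 1 ->
  Keps (PGL2_of (mx2 a b c d)).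
Proof.
move=> ai bi ci di ei e1; apply/KepsP.
exists (mx2 a b c d), (e *: mx2 d (- b) (- c) a); split; rewrite ?mx2Z ?mx2_mxOver ?rpredM ?rpredN//.
by rewrite mx2M mx2_1; congr mx2; rewrite -?e1; ring.
Qed.

Lemma mx2_inv_det (A : comPzRingType) (a b c d a' b' c' d' : A) :
  mx2 a b c d *m mx2 a' b' c' d' = 1%:M ->
  (a * d - b * c) * (a' * d' - b' * c') = 1.
Proof.
rewrite mx2M mx2_1 => /matrixP e.
have := (e 0 0, e 0 1, e 1 0, e 1 1); rewrite !mxE /= => -[[[e0 e1] e2] e3].
have -> : (a * d - b * c) * (a' * d' - b' * c') =
  (a * a' + b * c') * (c * b' + d * d') - (a * b' + b * d') * (c * a' + d * c') by ring.
by rewrite e0 e1 e2 e3; ring.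
Qed.

Lemma mx2_unit (a b c d : F) : a * d - b * c != 0 -> mx2 a b c d \in unitmx.
Proof.
move=> e0; apply: (@invmx_eq _ _ _ ((a * d - b * c)^-1 *: mx2 d (- b) (- c) a) _).1.
by rewrite mx2Z mx2M mx2_1; congr mx2; field.
Qed.

Lemma Keps_one_plus_eps N : N \is a mxOver (@oint F) -> Keps (one_plus_eps N).
Proof.
move=> /mxOverP Ni; apply/KepsP.
exists (1%:M + dual_eps F *: map_mx (@dualC F) N), (1%:M + dual_eps F *: map_mx (@dualC F) (- N)).
rewrite one_plus_epsM subrr map_mx0 scaler0 addr0.
have ei : dual_eps F \in @dint F by rewrite in_dint dual0_eps dual1_eps rpred0 rpred1.
have ii (i j : 'I_2) : (1%:M : 'M[dual_numbers F]_2) i j \in @dint F.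
  by rewrite mxE rpredMn// rpred1.
split=> //; apply/mxOverP => i j; rewrite [fun_of_matrix _ _ _]mxE rpredD//;
  rewrite [fun_of_matrix _ _ _]mxE rpredM// mxE dualC_dint// ?mxE ?rpredN; exact: Ni.
Qed.

Lemma emb1 : emb 1%:M = 1%g.
Proof. by rewrite /emb map_mx1 PGL2_of1. Qed.

(** Separates a coset representative into an infinitesimal factor, on which [f] is governed by
    [psi0], and a step on the tree. *)
Lemma hecke_mx_upper (p s t : F) : p != 0 -> PGL2_of (mx2 (dualC p) (dual s t) 0 1) =
  (one_plus_eps (mx2 0 t 0 0)%R * emb (mx2 p s 0 1)%R)%g.
Proof.
move=> p0; have uH : mx2 p s 0 1 \in unitmx by apply: mx2_unit; rewrite mulr1 mulr0 subr0.
rewrite /one_plus_eps /emb -(PGL2_ofM (one_plus_eps_unit _) (unitmx_dualC uH)).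
congr PGL2_of; have c0 : dualC 0 = 0 :> dual_numbers F by apply: rmorph0.
have c1 : dualC 1 = 1 :> dual_numbers F by apply: rmorph1.
rewrite !map_mx2 c0 c1 mx2_1 mx2Z mx2D mx2M /dual.
by rewrite !(mulr0, mul0r, addr0, add0r, mulr1, mul1r).
Qed.

Lemma hecke_mx_lower (p t : F) : p != 0 -> PGL2_of (mx2 1 0 (dual 0 t) (dualC p)) =
  (one_plus_eps (mx2 0 0 t 0)%R * emb (mx2 1 0 0 p)%R)%g.
Proof.
move=> p0; have uH : mx2 1 0 0 p \in unitmx by apply: mx2_unit; rewrite mul1r mulr0 subr0.
rewrite /one_plus_eps /emb -(PGL2_ofM (one_plus_eps_unit _) (unitmx_dualC uH)).
congr PGL2_of; have c0 : dualC 0 = 0 :> dual_numbers F by apply: rmorph0.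
have c1 : dualC 1 = 1 :> dual_numbers F by apply: rmorph1.
rewrite !map_mx2 c0 c1 mx2_1 mx2Z mx2D mx2M /dual c0.
by rewrite !(mulr0, mul0r, addr0, add0r, mulr1, mul1r).
Qed.

End Embedding.

#[global] Opaque emb one_plus_eps.

(** * Conjugates of [m] and their coordinates at a vertex *)

Section Conjugation.
Variable F : nonarchLocalFieldType.
Variable m : 'M[F]_2.
Implicit Types M H : 'M[F]_2.

Definition conj_mx M := invmx M *m m *m M.

Lemma conj_mxM M H H' : M \in unitmx -> H *m H' = 1%:M ->
  conj_mx (M *m H) = H' *m conj_mx M *m H.
Proof.
move=> uM HH; have [uH HV] := invmx_eq HH; rewrite /conj_mx.
have -> : invmx (M *m H) = H' *m invmx M.
  apply: (invmx_eq _).2; rewrite mulmxA -(mulmxA M) HH mulmx1 mulmxV//.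
by rewrite !mulmxA.
Qed.

Lemma conj_mxZ (a : F) M : a != 0 -> M \in unitmx -> conj_mx (a *: M) = conj_mx M.
Proof.
move=> a0 uM; rewrite /conj_mx invmxZ ?unitmxZ ?unitfE//.
by rewrite -scalemxAl -scalemxAr -scalemxAl scalerA mulfV// scale1r.
Qed.

Lemma conj_mx_tr M : M \in unitmx -> \tr (conj_mx M) = \tr m.
Proof. by move=> uM; rewrite /conj_mx -mulmxA mxtrace_mulC mulmxK. Qed.

(** A relation instead of three functions of [M]: each move below transports the coordinates by an
    explicit formula. *)
Definition coords M (a b c : F) := conj_mx M = mx2 a b c (- a).

Lemma coords_exist M : sl2 m -> M \in unitmx ->
  coords M (conj_mx M 0 0) (conj_mx M 0 1) (conj_mx M 1 0).
Proof.
rewrite /sl2 /= => m0 uM; rewrite /coords {1}[conj_mx M]mx2_eta; congr mx2.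
have := conj_mx_tr uM; rewrite m0 [conj_mx M]mx2_eta mx2_tr !mxE /=.
by move/eqP; rewrite addrC addr_eq0 => /eqP.
Qed.

(** Being the same at every vertex, [a^2 + b c] controls [a] once [b] and [c] are known to be
    integral. *)
Lemma coords_det M a b c : M \in unitmx -> coords M a b c ->
  a ^+ 2 + b * c = - \det m.
Proof.
move=> uM cM; have -> : \det m = \det (conj_mx M).
  rewrite /conj_mx !det_mulmx det_inv mulrAC mulVf ?mul1r//.
  by rewrite -unitfE.
rewrite cM (expand_det_row _ 0) !big_ord_recl big_ord0 !mxE /cofactor /=.
by rewrite !det_mx11 !mxE /=; ring.
Qed.

Variable p : F.
Hypothesis p0 : p != 0.

(** The expression [b + 2 a t - c t^2] vanishes exactly when [conj_mx M] preserves the line through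
    [(t, 1)]; modulo powers of [p] it tells which neighbours are fixed. *)
Lemma coords_child M a b c t : M \in unitmx -> coords M a b c ->
  coords (M *m mx2 p t 0 1) (a - t * c) ((b + 2 * a * t - c * t ^+ 2) / p) (p * c).
Proof.
move=> uM cM; rewrite /coords (@conj_mxM _ _ (mx2 p^-1 (- t / p) 0 1))//; last first.
  by rewrite mx2M mx2_1; congr mx2; field.
by rewrite cM !mx2M; congr mx2; field.
Qed.

(** Since [mx2 0 1 p 0] is [mx2 1 0 0 p] times the swap, this move reaches the same vertex as
    [mx2 1 0 0 p], but in a basis for which the old vertex is the parent. *)
Lemma coords_flip M a b c : M \in unitmx -> coords M a b c ->
  coords (M *m mx2 0 1 p 0) (- a) (c / p) (b * p).
Proof.
move=> uM cM; rewrite /coords (@conj_mxM _ _ (mx2 0 p^-1 1 0))//; last first.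
  by rewrite mx2M mx2_1; congr mx2; field.
by rewrite cM !mx2M; congr mx2; field.
Qed.

(** For integral [t] this stays at the same vertex; it moves the value of the quadratic form at [t]
    into the lower left corner. *)
Lemma coords_rot M a b c t : M \in unitmx -> coords M a b c ->
  coords (M *m mx2 t 1 1 0) (c * t - a) c (b + 2 * a * t - c * t ^+ 2).
Proof.
move=> uM cM; rewrite /coords (@conj_mxM _ _ (mx2 0 1 1 (- t)))//; last first.
  by rewrite mx2M mx2_1; congr mx2; ring.
by rewrite cM !mx2M; congr mx2; ring.
Qed.

Lemma coords_shear M a b c t : M \in unitmx -> coords M a b c ->
  coords (M *m mx2 1 t 0 1) (a - t * c) (b + 2 * a * t - c * t ^+ 2) c.
Proof.
move=> uM cM; rewrite /coords (@conj_mxM _ _ (mx2 1 (- t) 0 1))//; last first.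
  by rewrite mx2M mx2_1; congr mx2; ring.
by rewrite cM !mx2M; congr mx2; ring.
Qed.

End Conjugation.

(** * Cosets in the Hecke double coset *)

Section Factorizations.
Variable A : comPzRingType.
Implicit Types a b c d e t y P : A.

Lemma mx2_upper_factor P t : mx2 P t 0 1 = mx2 1 t 0 1 *m mx2 P 0 0 1.
Proof. by rewrite mx2M; congr mx2; ring. Qed.

Lemma mx2_lower_factor P t :
  mx2 1 0 t P = mx2 0 1 1 t *m mx2 P 0 0 1 *m mx2 0 1 1 0.
Proof. by rewrite !mx2M; congr mx2; ring. Qed.

Lemma mx2_upperV t : mx2 1 t 0 1 *m mx2 1 (- t) 0 1 = 1%:M.
Proof. by rewrite mx2M mx2_1; congr mx2; ring. Qed.

Lemma mx2_swapV t : mx2 0 1 1 t *m mx2 (- t) 1 1 0 = 1%:M.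
Proof. by rewrite mx2M mx2_1; congr mx2; ring. Qed.

Lemma mx2_upper_det t : (1 * 1 - t * 0) * 1 = 1 :> A.
Proof. by ring. Qed.

Lemma mx2_swap_det t : (0 * t - 1 * 1) * -1 = 1 :> A.
Proof. by ring. Qed.

(** When [d] is invertible, the class [t] of [b / d] modulo [P] selects the representative. The
    determinant identity puts the remaining factor into [Keps]. *)
Lemma mx2_upper_reduction P a b c d t y : b = (t + P * y) * d ->
  mx2 a b c d *m mx2 P 0 0 1 = mx2 P t 0 1 *m mx2 (a - t * c) (y * d) (P * c) d /\
  (a - t * c) * d - (y * d) * (P * c) = a * d - b * c.
Proof. by move=> ->; rewrite !mx2M; split; [congr mx2|]; ring. Qed.

Lemma mx2_lower_reduction P a b c d t y : d = (t + P * y) * b ->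
  mx2 a b c d *m mx2 P 0 0 1 = mx2 1 0 t P *m mx2 (P * a) b (c - t * a) (y * b) /\
  (P * a) * (y * b) - b * (c - t * a) = a * d - b * c.
Proof. by move=> ->; rewrite !mx2M; split; [congr mx2|]; ring. Qed.

End Factorizations.

Lemma fsbig_finType (V : nmodType) (I : finType) (f : I -> V) :
  \sum_(i \in [set: I]) f i = \sum_i f i.
Proof.
have -> : [set: I] = [set` enum I].
  by apply/seteqP; split=> // x _ /=; rewrite mem_enum.
by rewrite -fsbig_seq ?enum_uniq// big_enum.
Qed.

Section Cosets.
Variable F : nonarchLocalFieldType.
Local Notation D := (dual_numbers F).
Local Notation Geps := (PGL2 D).
Local Notation q := (residue_card F).
Variable p : F.
Hypotheses (p0 : p != 0) (p1 : ordv p = 1).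
Variable r : 'I_q -> F.
Hypotheses (r_oint : forall i, r i \in @oint F)
  (r_surj : forall x, x \in @oint F -> exists i, x - r i \in @fideal F 1)
  (r_inj : forall i j, r i - r j \in @fideal F 1 -> i = j).
Let P : D := dualC p.
Let base : 'M[D]_2 := mx2 P 0 0 1.

Let p_int : p \in @oint F. Proof. by rewrite in_fideal p1 orbT. Qed.
Let P_int : P \in @dint F. Proof. exact: dualC_dint. Qed.

Lemma left_cosetP (g h : Geps) :
  left_coset g = left_coset h <-> Keps (g^-1 * h)%g.
Proof.
split=> [e|k].
  have : left_coset h h by exists 1%g; [exact: Keps1 | rewrite mulg1].
  by rewrite -e => -[k ke <-]; rewrite mulKg.
apply/seteqP; split=> x [l li <-].
  exists ((g^-1 * h)^-1 * l)%g; first by apply: KepsM => //; apply: KepsV.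
  by rewrite invgM invgK !mulgA mulgV mul1g.
by exists ((g^-1 * h) * l)%g; [exact: KepsM | rewrite !mulgA mulgV mul1g].
Qed.

(** The index set is the projective line over the dual numbers of the residue field: [q^2] finite
    points and [q] points reducing to infinity. *)
Definition hecke_mx (i : ('I_q * 'I_q) + 'I_q) : 'M[D]_2 :=
  match i with
  | inl (j, k) => mx2 P (dual (r j) (r k)) 0 1
  | inr k => mx2 1 0 (dual 0 (r k)) P
  end.

Let PV : D := dualC p^-1.
Let PPV : P * PV = 1. Proof. by rewrite -rmorphM mulfV// rmorph1. Qed.

Lemma hecke_mx_unit i : hecke_mx i \in unitmx.
Proof.
case: i => [[j k]|k] /=.
  apply: (@invmx_eq _ _ _ (mx2 PV (- PV * dual (r j) (r k)) 0 1) _).1.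
  rewrite mx2M mx2_1; congr mx2; rewrite ?mulr0 ?mul0r ?addr0 ?add0r ?mulr1//.
  by rewrite mulrA mulrN PPV mulN1r addNr.
apply: (@invmx_eq _ _ _ (mx2 1 0 (- PV * dual 0 (r k)) PV) _).1.
rewrite mx2M mx2_1; congr mx2; rewrite ?mulr0 ?mul0r ?addr0 ?add0r ?mulr1//.
by rewrite mulrA mulrN PPV mulN1r subrr.
Qed.

Let base_unit : base \in unitmx.
Proof.
apply: (@invmx_eq _ _ _ (mx2 PV 0 0 1) _).1.
by rewrite mx2M mx2_1; congr mx2; rewrite ?mulr0 ?mul0r ?addr0 ?add0r ?mulr1.
Qed.

Let fideal1_P (x : D) : dual0 x \in @fideal F 1 -> dual1 x \in @fideal F 1 ->
  exists2 y, y \in @dint F & x = P * y.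
Proof.
move=> x0 x1; exists (dual (dual0 x / p) (dual1 x / p)).
  by apply: dual_dint; rewrite /oint fidealVM// add0r p1.
by apply: dual_ext; rewrite ?dual0M ?dual1M ?dual0E ?dual1E dual0C ?dual1C; field.
Qed.

Let P_fideal1 (y : D) : y \in @dint F ->
  dual0 (P * y) \in @fideal F 1 /\ dual1 (P * y) \in @fideal F 1.
Proof.
have pf : p \in @fideal F 1 by rewrite in_fideal p1 orbT.
rewrite in_dint => /andP[y0 y1].
by rewrite dual0M dual1M dual0C dual1C mul0r addr0; split; apply: fidealMr.
Qed.

(** Equal cosets give [hecke_mx j = u (hecke_mx i) X] with [X] integrally invertible. Comparing
    entries, representatives of different kinds would make [p] a unit, and those of the same kind
    have residues agreeing modulo [P]. *)
Lemma hecke_mx_inj i j :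
  Keps ((PGL2_of (hecke_mx i))^-1 * PGL2_of (hecke_mx j))%g -> i = j.
Proof.
have eqs i' j' : Keps ((PGL2_of (hecke_mx i'))^-1 * PGL2_of (hecke_mx j'))%g ->
    exists u a b c d a' b' c' d' : D,
    [/\ u \is a GRing.unit, hecke_mx j' = u *: (hecke_mx i' *m mx2 a b c d),
     [/\ a \in @dint F, b \in @dint F, c \in @dint F & d \in @dint F],
     [/\ a' \in @dint F, b' \in @dint F, c' \in @dint F & d' \in @dint F] &
     [/\ a * a' + b * c' = 1, a * b' + b * d' = 0, c * a' + d * c' = 0 &
        c * b' + d * d' = 1]].
  move=> /KepsP[X [Y [XY /mxOverP Xi /mxOverP Yi kE]]].
  have uX : X \in unitmx := (invmx_eq XY).1.
  have : PGL2_of (hecke_mx j') = PGL2_of (hecke_mx i' *m X).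
    by rewrite PGL2_ofM ?hecke_mx_unit// -kE mulgA mulgV mul1g.
  move=> /PGL2_of_eqP[||u uu hE]; rewrite ?unitmx_mul ?hecke_mx_unit//.
  exists u, (X 0 0), (X 0 1), (X 1 0), (X 1 1), (Y 0 0), (Y 0 1), (Y 1 0), (Y 1 1).
  split; [exact: uu | by rewrite -mx2_eta | | |].
  - by split; [exact: Xi 0 0 | exact: Xi 0 1 | exact: Xi 1 0 | exact: Xi 1 1].
  - by split; [exact: Yi 0 0 | exact: Yi 0 1 | exact: Yi 1 0 | exact: Yi 1 1].
  move: XY; rewrite {1}(mx2_eta X) {1}(mx2_eta Y) mx2M mx2_1 => /matrixP e.
  by have := (e 0 0, e 0 1, e 1 0, e 1 1); rewrite !mxE /= => -[[[]]].
have mixed a0 b0 k :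
    ~ Keps ((PGL2_of (hecke_mx (inl (a0, b0))))^-1 * PGL2_of (hecke_mx (inr k)))%g.
  move=> /eqs[u [a [b [c [d [a' [b' [c' [d' [uu]]]]]]]]]]; rewrite /= mx2M mx2Z.
  set t := dual (r _) _ => /matrixP e [ai bi ci di] [ai' bi' ci' di'] [_ _ _ e3].
  have := (e 0 0, e 0 1, e 1 0, e 1 1); rewrite !mxE /= => -[[[h0 h1] h2] h3].
  have u0 : dual0 u != 0 by rewrite -dual_unit.
  have c0 : dual0 c = 0.
    move/(congr1 (@dual0 F)): h2.
    rewrite mul0r add0r mul1r dual0M dual0E => /esym/eqP.
    by rewrite mulf_eq0 (negPf u0) => /eqP.
  have a1 : dual0 u * (p * dual0 a) = 1.
    move/(congr1 (@dual0 F)): h0.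
    by rewrite dual0_1 dual0M rmorphD /= !dual0M c0 mulr0 addr0 dual0C => <-.
  have d1 : p = dual0 u * dual0 d.
    move/(congr1 (@dual0 F)): h3.
    by rewrite mul0r add0r mul1r !dual0M dual0C.
  have d1' : dual0 d * dual0 d' = 1.
    by move/(congr1 (@dual0 F)): e3; rewrite dual0_1 rmorphD /= !dual0M c0 mul0r add0r.
  have ppd : p * (p * dual0 a * dual0 d') = 1.
    rewrite {1}d1.
    have -> : dual0 u * dual0 d * (p * dual0 a * dual0 d') =
      (dual0 u * (p * dual0 a)) * (dual0 d * dual0 d') by ring.
    by rewrite a1 d1' mulr1.
  have : p * (p * dual0 a * dual0 d') \in @fideal F 1.
    apply: fidealMr; first by rewrite in_fideal p1 orbT.
    move: ai di'; rewrite !in_dint => /andP[a0i _] /andP[d0i _].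
    by rewrite !rpredM.
  by rewrite ppd in_fideal oner_eq0 ordv1.
move=> K; case: i K => [[a0 b0]|a0]; case: j => [[c0 d0]|c0] K.
- move: K => /eqs[u [a [b [c [d [a' [b' [c' [d' [uu]]]]]]]]]]; rewrite /= mx2M mx2Z.
  set s := dual (r a0) _; set t := dual (r c0) _.
  move=> /matrixP e [ai bi ci di] [ai' bi' ci' di'] [_ _ _ e3].
  have := (e 0 0, e 0 1, e 1 0, e 1 1); rewrite !mxE /= => -[[[h0 h1] h2] h3].
  have cz : c = 0.
    by apply: (mulrI uu); rewrite mulr0 h2 mul0r add0r mul1r.
  have ud : u * d = 1 by rewrite h3 mul0r add0r mul1r.
  (* A priori [u] is only a unit of [F_eps]; it is integral because it equals an entry of the
     inverse of [X]. *)
  have ui : u \in @dint F.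
    have -> : u = d'.
      by rewrite -[u]mulr1 -e3 cz mul0r add0r mulrA ud mul1r.
    by [].
  have ts : t - s = P * (u * b).
    rewrite h1 mulrDr [u * (s * d)]mulrCA ud mulr1 addrK.
    by rewrite mulrCA.
  have ubi : u * b \in @dint F by rewrite rpredM.
  have [] := P_fideal1 ubi; rewrite -ts !raddfB /= !dual0E !dual1E.
  by move=> /r_inj -> /r_inj ->.
- by have := mixed _ _ _ K.
- by have := KepsV K; rewrite invgM invgK => /mixed.
- move: K => /eqs[u [a [b [c [d [a' [b' [c' [d' [uu]]]]]]]]]]; rewrite /= mx2M mx2Z.
  set s := dual 0 (r a0); set t := dual 0 (r c0).
  move=> /matrixP e [ai bi ci di] [ai' bi' ci' di'] [e0 _ _ _].
  have := (e 0 0, e 0 1, e 1 0, e 1 1); rewrite !mxE /= => -[[[h0 h1] h2] h3].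
  have bz : b = 0.
    by apply: (mulrI uu); rewrite mulr0 h1 mul0r addr0 mul1r.
  have ua : u * a = 1 by rewrite h0 mul0r addr0 mul1r.
  have ui : u \in @dint F.
    have -> : u = a'.
      by rewrite -[u]mulr1 -e0 bz mul0r addr0 mulrA ua mul1r.
    by [].
  have ts : t - s = P * (u * c).
    rewrite h2 mulrDr [u * (s * a)]mulrCA ua mulr1 addrC addKr.
    by rewrite mulrCA.
  have uci : u * c \in @dint F by rewrite rpredM.
  have [_] := P_fideal1 uci; rewrite -ts !raddfB /= !dual1E.
  by move=> /r_inj ->.
Qed.

Lemma Keps_cancel (X Y Z : 'M[D]_2) : X \in unitmx -> Y \in unitmx ->
  Y = X *m Z -> Keps (PGL2_of Z) -> Keps ((PGL2_of X)^-1 * PGL2_of Y)%g.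
Proof.
move=> uX uY YE; have uZ : Z \in unitmx by move: uY; rewrite YE unitmx_mul uX.
by rewrite YE (PGL2_ofM uX uZ) mulKg.
Qed.

(** The determinant of [X] is a unit, so [b] or [d] is one. If [d] is, the class of [b / d] gives an
    upper representative; otherwise the class of [d / b], whose constant term vanishes in the
    residue field, gives a lower one. *)
Lemma hecke_mx_surj (X : Geps) : Keps X ->
  exists i, Keps ((PGL2_of (hecke_mx i))^-1 * (X * PGL2_of base))%g.
Proof.
move=> /KepsP[{}X [Y [XY /mxOverP Xi /mxOverP Yi ->]]].
have uX : X \in unitmx := (invmx_eq XY).1.
move: XY (uX); rewrite (mx2_eta X) (mx2_eta Y).
move: (Xi 0 0) (Xi 0 1) (Xi 1 0) (Xi 1 1) (Yi 0 0) (Yi 0 1) (Yi 1 0) (Yi 1 1).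
move: (X 0 0) (X 0 1) (X 1 0) (X 1 1) (Y 0 0) (Y 0 1) (Y 1 0) (Y 1 1) => a b c d a' b' c' d'.
move=> ai bi ci di ai' bi' ci' di' /mx2_inv_det; set e := a' * d' - b' * c' => dete uX'.
have ei : e \in @dint F by rewrite rpredB ?rpredM.
have split_rep (x : D) : x \in @dint F -> exists i j, exists2 y, y \in @dint F &
    x = dual (r i) (r j) + P * y.
  rewrite in_dint => /andP[/r_surj[i hi] /r_surj[j hj]]; exists i, j.
  have [||y yi yE] := @fideal1_P (x - dual (r i) (r j)); rewrite ?raddfB /= ?dual0E ?dual1E//.
  by exists y; rewrite // -yE addrC subrK.
have unit_dint (x : D) : x \in @dint F -> dual0 x \notin @fideal F 1 ->
    exists2 y, y \in @dint F & x * y = 1.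
  rewrite in_dint => /andP[x0 x1] xn; have [xz xv] := @ordv_eqP _ 0 _ x0 xn.
  have xVi : (dual0 x)^-1 \in @oint F by rewrite in_fideal ordvV// xv oppr0 lexx orbT.
  exists (dual (dual0 x)^-1 (- dual1 x * (dual0 x)^-1 ^+ 2)).
    by rewrite dual_dint// rpredM ?rpredN// rpredX.
  apply: dual_ext; rewrite ?dual0M ?dual1M !dual0E ?dual1E ?dual0_1 ?dual1_1; field => //.
rewrite -(PGL2_ofM uX' base_unit).
have uXb : mx2 a b c d *m base \in unitmx by rewrite unitmx_mul uX' base_unit.
have [dn|du] := boolP (dual0 d \in @fideal F 1); last first.
  have [dV dVi ddV] := unit_dint _ di du.
  have [|i [j [y yi bE]]] := split_rep (b * dV); first by rewrite rpredM.
  exists (inl (i, j)); set t := dual _ _ in bE.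
  have bE' : b = (t + P * y) * d by rewrite -bE -mulrA [dV * d]mulrC ddV mulr1.
  have [XE detE] := mx2_upper_reduction a c bE'.
  apply: (@Keps_cancel _ _ _ (hecke_mx_unit (inl (i, j))) uXb XE).
  apply: (@Keps_mx2 _ _ _ _ _ e) => //; rewrite ?detE//.
  - by rewrite rpredB// rpredM// dual_dint.
  - by rewrite rpredM.
  - by rewrite rpredM.
have bu : dual0 b \notin @fideal F 1.
  apply/negP => bn; move/(congr1 (@dual0 F)): dete.
  rewrite dual0M raddfB /= !dual0M dual0_1 => e1.
  have : 1 \in @fideal F 1.
    move: ai ci ei; rewrite !in_dint => /andP[ai _] /andP[ci _] /andP[ei _].
    rewrite -e1; apply: fidealMr => //; apply: rpredB.
      exact: fidealMl.
    exact: fidealMr.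
  by rewrite in_fideal oner_eq0 ordv1.
have [bV bVi bbV] := unit_dint _ bi bu.
have xi : d * bV \in @dint F by rewrite rpredM.
have [j hj] : exists j, dual1 (d * bV) - r j \in @fideal F 1.
  by apply: r_surj; move: xi; rewrite in_dint => /andP[].
have [||y yi yE] := @fideal1_P (d * bV - dual 0 (r j)).
- rewrite raddfB /= dual0E subr0 dual0M; apply: fidealMr => //.
  by move: bVi; rewrite in_dint => /andP[].
- by rewrite raddfB /= dual1E.
exists (inr j); set t := dual _ _ in yE.
have dE : d = (t + P * y) * b by rewrite -yE addrC subrK -mulrA [bV * b]mulrC bbV mulr1.
have [XE detE] := mx2_lower_reduction a c dE.
apply: (@Keps_cancel _ _ _ (hecke_mx_unit (inr j)) uXb XE).
apply: (@Keps_mx2 _ _ _ _ _ e) => //; rewrite ?detE//.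
- by rewrite rpredM.
- by rewrite rpredB// rpredM// dual_dint// ?rpred0.
by rewrite rpredM.
Qed.

Lemma hecke_mx_double_coset i :
  exists k l, [/\ Keps k, Keps l & PGL2_of (hecke_mx i) = (k * PGL2_of base * l)%g].
Proof.
have swapK (t : D) : t \in @dint F -> Keps (PGL2_of (mx2 0 1 1 t)).
  move=> ti; apply: (@Keps_mx2 _ _ _ _ _ (-1)) (mx2_swap_det t);
  by rewrite ?rpredN ?rpred1 ?rpred0.
have swap_unit (t : D) : mx2 0 1 1 t \in unitmx := (invmx_eq (mx2_swapV t)).1.
case: i => [[j k]|k] /=; set t := dual _ _.
  have ti : t \in @dint F by rewrite dual_dint.
  exists (PGL2_of (mx2 1 t 0 1)), 1%g; split; [|exact: Keps1|].
    by apply: (@Keps_mx2 _ _ _ _ _ 1) (mx2_upper_det t); rewrite ?rpred1 ?rpred0.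
  rewrite mulg1 -(PGL2_ofM (invmx_eq (mx2_upperV t)).1 base_unit).
  by rewrite (mx2_upper_factor P t).
have ti : t \in @dint F by rewrite dual_dint ?rpred0.
exists (PGL2_of (mx2 0 1 1 t)), (PGL2_of (mx2 0 1 1 0)).
split; [exact: swapK | exact: swapK (rpred0 _) |].
have ukb : mx2 0 1 1 t *m base \in unitmx by rewrite unitmx_mul swap_unit base_unit.
rewrite -(PGL2_ofM (swap_unit t) base_unit) -(PGL2_ofM ukb (swap_unit 0)).
by rewrite (mx2_lower_factor P t).
Qed.

(** The matrices [hecke_mx i] represent each coset exactly once, and right invariance replaces the
    point chosen by [xget] with them. *)
Lemma hecke_sum (C : fieldType) (f : Geps -> C) (g : Geps) :
  (forall k h, Keps k -> f (h * k)%g = f h) ->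
  \sum_(c \in left_cosets_in (double_coset (hecke_elt p 0))) f (g * xget 1%g c)%g =
  \sum_j \sum_k f (g * PGL2_of (hecke_mx (inl (j, k))))%g +
  \sum_k f (g * PGL2_of (hecke_mx (inr k)))%g.
Proof.
move=> fK.
have hE : hecke_elt p 0 = PGL2_of base.
  by rewrite /hecke_elt rmorph0 mulr0 addr0 diag2E.
have cE : left_cosets_in (double_coset (hecke_elt p 0)) =
    (fun i => left_coset (PGL2_of (hecke_mx i))) @` setT.
  rewrite hE; apply/seteqP; split=> [c [[h ->] hD]|c [i _ <-]].
    have : left_coset h h by exists 1%g; [exact: Keps1 | rewrite mulg1].
    move=> /hD [k1 [k2 [k1K k2K hk]]].
    have [i Ki] := hecke_mx_surj k1K; exists i; first exact: I.
    apply/left_cosetP; rewrite hk mulgA; exact: KepsM Ki k2K.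
  split; first by exists (PGL2_of (hecke_mx i)).
  move=> _ [k kK <-]; have [k1 [k2 [k1K k2K ->]]] := hecke_mx_double_coset i.
  exists k1, (k2 * k)%g; split; [exact: k1K | exact: KepsM k2K kK | by rewrite !mulgA].
rewrite cE fsbig_image; last first.
  by move=> i j _ _ /left_cosetP; apply: hecke_mx_inj.
have fE i : f (g * xget 1%g (left_coset (PGL2_of (hecke_mx i))))%g =
    f (g * PGL2_of (hecke_mx i))%g.
  have : left_coset (PGL2_of (hecke_mx i)) (xget 1%g (left_coset (PGL2_of (hecke_mx i)))).
    apply: xgetPex; exists (PGL2_of (hecke_mx i)), 1%g; [exact: Keps1 | exact: mulg1].
  by move=> [k kK <-]; rewrite mulgA; exact: fK kK.
under eq_fsbigr do rewrite fE.
rewrite fsbig_finType big_sumType /=; congr (_ + _).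
by rewrite pair_big /=; apply: eq_bigr => -[].
Qed.

End Cosets.

(** * Boundedness of levels on compact sets *)

Section Boundedness.
Variable F : nonarchLocalFieldType.
Variable m : 'M[F]_2.

Lemma mxOver_fidealMl k n (X : 'M[F]_n) (Y : 'M[F]_n) : X \is a mxOver (@oint F) ->
  Y \is a mxOver (@fideal F k) -> X *m Y \is a mxOver (@fideal F k).
Proof.
move=> /mxOverP hX /mxOverP hY; apply/mxOverP => i j; rewrite mxE.
by apply: rpred_sum => l _; apply: fidealMl.
Qed.

Lemma mxOver_fidealMr k n (X : 'M[F]_n) (Y : 'M[F]_n) : X \is a mxOver (@fideal F k) ->
  Y \is a mxOver (@oint F) -> X *m Y \is a mxOver (@fideal F k).
Proof.
move=> /mxOverP hX /mxOverP hY; apply/mxOverP => i j; rewrite mxE.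
by apply: rpred_sum => l _; apply: fidealMr.
Qed.

Lemma mxOver_fideal_exists n (X : 'M[F]_n) : exists k : nat, X \is a mxOver (@fideal F (- k%:Z)).
Proof.
exists (\sum_i \sum_j `|ordv (X i j)|)%N; apply/mxOverP => i j.
have : (`|ordv (X i j)| <= \sum_i \sum_j `|ordv (X i j)|)%N.
  by rewrite (bigD1 i)//= (bigD1 j)//= -addnA leq_addr.
by rewrite in_fideal; lia.
Qed.

(** The determinant is [1 + e] with [e] in the maximal ideal, hence a unit, and the adjugate gives
    the inverse. *)
Lemma one_plus_fideal_inv (X : 'M[F]_2) : X \is a mxOver (@fideal F 1) ->
  exists2 Y, (1%:M + X) *m Y = 1%:M & Y \is a mxOver (@oint F).
Proof.
move=> /mxOverP hX; rewrite (mx2_eta X) mx2_1 mx2D !add0r.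
move: (hX 0 0) (hX 0 1) (hX 1 0) (hX 1 1).
move: (X 0 0) (X 0 1) (X 1 0) (X 1 1) => a b c d ha hb hc hd.
have oi x : x \in @fideal F 1 -> x \in @oint F by apply: fidealW.
pose e := a + d + a * d - b * c.
have he : e \in @fideal F 1.
  by rewrite rpredB// ?rpredD//; apply: fidealMr => //; apply: oi.
have e0 : 1 + e != 0.
  apply/eqP => /eqP; rewrite addrC addr_eq0 => /eqP ee; move: he.
  by rewrite ee rpredN in_fideal oner_eq0 ordv1.
have ev : ordv (1 + e) = 0.
  have eo : 1 + e \in @oint F by rewrite rpredD ?rpred1 ?oi.
  have en : 1 + e \notin @fideal F (0 + 1).
    apply/negP => h; have : 1 \in @fideal F 1 by rewrite -(addrK e 1) rpredB.
    by rewrite in_fideal oner_eq0 ordv1.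
  exact: (ordv_eqP eo en).2.
have ei : (1 + e)^-1 \in @oint F by rewrite in_fideal ordvV// ev oppr0 lexx orbT.
exists ((1 + e)^-1 *: mx2 (1 + d) (- b) (- c) (1 + a)).
  by rewrite -scalemxAr mx2M mx2Z /e; congr mx2; rewrite /e in e0; field.
rewrite mx2Z mx2_mxOver// rpredM ?rpredN ?rpredD ?rpred1//; exact: oi.
Qed.

(** A matrix close to [g] is [g (1 + X)] with [X] small, so it differs from [g] by an element of
    [GL_2(O)], and conjugation by such an element preserves divisibility. *)
Lemma open_conj_not_mxOver k :
  open [set g : PGL2 F | conj_mx m (PGL2_mx g) \isn't a mxOver (@fideal F k)].
Proof.
pose U := [set M : GL2 F | conj_mx m M \isn't a mxOver (@fideal F k)].
suff oU : open U.
  set S : set (PGL2 F) := [set g | _].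
  (* Openness in the quotient is openness of the preimage; the representative taken by [PGL2_mx]
     differs by a scalar, which [conj_mx] ignores. *)
  have SU : (fun g : GL2 F => \pi_(PGL2 F) g) @^-1` S = U.
    apply/seteqP; split=> g; rewrite /S /U /= -PGL2_of_GL2;
      have [a] := PGL2_mx_of (GL2_unit g); rewrite unitfE => a0 ->;
      by rewrite conj_mxZ ?GL2_unit.
  by move: oU; rewrite -SU.
rewrite openE => g Ug; rewrite /interior.
have [n hn] := mxOver_fideal_exists (invmx (g : 'M[F]_2)).
have cont := @initial_continuous _ _ (@GL2_val F) g.
(* The entries of [invmx g] have valuation at least [- n], so the radius [n + 1] puts
   [invmx g (h - g)] into the maximal ideal. *)
pose O := [set M : 'M[F]_2 | (M - (g : 'M[F]_2)) \is a mxOver (@fideal F (n%:Z + 1))].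
have : nbhs (g : 'M[F]_2) O.
  exists (fun i j => [set x | x - (g : 'M[F]_2) i j \in @fideal F (n%:Z + 1)]).
    move=> i j; rewrite -nbhs_entourageE; exists [set xy | xy.1 = xy.2 \/ n%:Z + 1 <= ordv (xy.1 - xy.2)].
      by rewrite entourage_ordvE; exists (n%:Z + 1).
    move=> x /xsectionP /= [->|h]; first by rewrite subrr rpred0.
    by rewrite -opprB rpredN in_fideal h orbT.
  by move=> M hM; apply/mxOverP => i j; rewrite !mxE; apply: hM.
move=> /cont Og; suff OU : @GL2_val F @^-1` O `<=` U by apply: (filterS OU); exact: Og.
move=> h; rewrite /O /U /= => hg.
have uh := GL2_unit h; have ug := GL2_unit g.
move: Ug; rewrite /U /=; apply: contraNN => hh.
pose X := invmx g *m ((h : 'M[F]_2) - (g : 'M[F]_2)).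
have X1 : X \is a mxOver (@fideal F 1).
  apply/mxOverP => i j; rewrite mxE; apply: rpred_sum => l _.
  have -> : 1 = - n%:Z + (n%:Z + 1) by rewrite addrA addNr add0r.
  by apply: fidealM; [move/mxOverP: hn | move/mxOverP: hg].
have [Y XY Yi] := one_plus_fideal_inv X1.
have YX := mulmx1C XY.
have X1i : 1%:M + X \is a mxOver (@oint F).
  apply/mxOverP => i j; rewrite mxE [1%:M i j]mxE rpredD ?rpredMn ?rpred1//.
  by apply: (@fidealW _ _ 1) => //; move/mxOverP: X1.
have gE : (g : 'M[F]_2) = h *m Y.
  have -> : (h : 'M[F]_2) = g *m (1%:M + X).
    by rewrite mulmxDr mulmx1 mulKVmx// addrC subrK.
  by rewrite -mulmxA XY mulmx1.
rewrite gE (conj_mxM m uh YX).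
by apply: mxOver_fidealMr => //; apply: mxOver_fidealMl.
Qed.

(** As [m != 0], the open sets where [conj_mx] is not divisible by the [n]-th power cover
    everything; they increase with [n], so one of them contains [B]. *)
Lemma compact_conj_bounded (B : set (PGL2 F)) : m != 0 -> compact B ->
  exists n : nat, forall g, B g -> conj_mx m (PGL2_mx g) \isn't a mxOver (@fideal F n%:Z).
Proof.
move=> m0 /compact_near_coveringP cB.
have mono g (j k : nat) : (j <= k)%N -> conj_mx m (PGL2_mx g) \isn't a mxOver (@fideal F j%:Z) ->
    conj_mx m (PGL2_mx g) \isn't a mxOver (@fideal F k%:Z).
  move=> jk; apply: contraNN => /mxOverP h; apply/mxOverP => i l.
  by apply: fidealW (h i l); rewrite lez_nat.
have [N _ hN] : \forall n \near \oo, B `<=` (fun g =>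
    is_true (conj_mx m (PGL2_mx g) \isn't a mxOver (@fideal F (n : nat)%:Z))).
  apply: cB => g _; have ug := PGL2_mx_unit g.
  have : conj_mx m (PGL2_mx g) != 0.
    apply: contra_neq m0 => c0.
    have -> : m = PGL2_mx g *m conj_mx m (PGL2_mx g) *m invmx (PGL2_mx g).
      by rewrite /conj_mx !mulmxA mulmxV// mul1mx mulmxK.
    by rewrite c0 mulmx0 mul0mx.
  move=> /matrix0Pn[i [j ij]].
  pose n0 := (`|ordv (conj_mx m (PGL2_mx g) i j)|%N).+1.
  have gn0 : conj_mx m (PGL2_mx g) \isn't a mxOver (@fideal F n0%:Z).
    apply/negP => /mxOverP/(_ i j); rewrite in_fideal (negPf ij) /= /n0.
    by move: (ordv _) => v; lia.
  exists ([set h | conj_mx m (PGL2_mx h) \isn't a mxOver (@fideal F n0%:Z)],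
          [set n | (n0 <= n)%N]).
    split => /=; last by exists n0.
    by apply: open_nbhs_nbhs; split=> //; exact: open_conj_not_mxOver.
  by move=> [h n] [/= hh nn]; exact: mono hh.
by exists N => g Bg; apply: (hN N _ g Bg) => /=.
Qed.

End Boundedness.

(** * The Hecke operator on vertices *)

Section Vertices.
Variables (R : realType) (F : nonarchLocalFieldType).
Local Notation C := R[i].
Hypothesis two : (2 : F) != 0.
Variable p : F.
Hypotheses (p0 : p != 0) (p1 : ordv p = 1).
Variables (psi0 : F -> C) (m : 'M[F]_2) (chi : PGL2 F -> C).
Hypothesis psi0_cond :
  [set x | forall y, integers y -> psi0 (x * y) = 1] = @integers F.
Variable f : PGL2 (dual_numbers F) -> C.
Hypothesis fV : Vspace psi0 m chi f.
Hypothesis fK : forall k g, Keps k -> f (g * k)%g = f g.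
Implicit Types M N H : 'M[F]_2.

Definition phi M : C := f (emb M).

Lemma phiZ a M : a != 0 -> M \in unitmx -> phi (a *: M) = phi M.
Proof. by move=> a0 uM; rewrite /phi (embZ a0 uM). Qed.

Lemma phiK M H H' : M \in unitmx -> H *m H' = 1%:M -> H \is a mxOver (@oint F) ->
  H' \is a mxOver (@oint F) -> phi (M *m H) = phi M.
Proof.
move=> uM HH Hi Hi'; rewrite /phi (embM uM (invmx_eq HH).1).
exact: fK (Keps_emb HH Hi Hi').
Qed.

Lemma phi_eps M N H : M \in unitmx -> H \in unitmx -> sl2 N ->
  f (emb M * one_plus_eps N * emb H)%g = psi0 (\tr (conj_mx m M *m N)) * phi (M *m H).
Proof.
move=> uM uH sN; rewrite (emb_one_plus_eps_emb N uM uH).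
have uMH : M *m H \in unitmx by rewrite unitmx_mul uM.
have sN' : sl2 (M *m N *m invmx M) by rewrite /sl2 /= mxtrace_mulC mulKmx.
have [_ fe _ _] := fV.
have := fe _ (PGL2_of (M *m H)) sN'; rewrite (G_to_Geps_emb uMH) => ->.
rewrite /psi /phi; congr (psi0 _ * _).
by rewrite -[RHS]/(\tr (invmx M *m m *m M *m N)) mulmxA [LHS]mxtrace_mulC !mulmxA.
Qed.

Lemma psi0_int x : x \in @oint F -> psi0 x = 1.
Proof.
move=> /integersP; rewrite -psi0_cond => /(_ 1); rewrite mulr1; apply.
by apply/integersP; rewrite rpred1.
Qed.

(** Invariance under [1 + eps N] for integral [N] gives [psi0 (tr (A N)) = 1] with
    [A = conj_mx m M]. Suitable [N] isolate each entry of [A], and the condition on [psi0] makes it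
    integral. *)
Lemma phi_support M a b c : M \in unitmx -> coords m M a b c -> phi M != 0 ->
  [/\ a \in @oint F, b \in @oint F & c \in @oint F].
Proof.
move=> uM cM f0.
have key N : sl2 N -> Keps (one_plus_eps N) -> psi0 (\tr (conj_mx m M *m N)) = 1.
  move=> sN kN; apply: (mulIf f0); rewrite mul1r.
  have := phi_eps uM (unitmx1 F 2) sN; rewrite mulmx1 => <-.
  by rewrite emb1 mulg1; exact: fK kN.
have intP x : (forall y, y \in @oint F -> psi0 (x * y) = 1) -> x \in @oint F.
  move=> h; apply/integersP; rewrite -psi0_cond => y /integersP; exact: h.
split; apply: intP => y yi.
- have := key (mx2 (y / 2) 0 0 (- (y / 2))).
  rewrite cM mx2M mx2_tr !(mulr0, mul0r, addr0, add0r) mulrNN -mulrDr.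
  have -> : y / 2 + y / 2 = y by field.
  apply.
    by rewrite /sl2 /= mx2_tr subrr.
  (* The traceless diagonal matrix need not be integral in residue characteristic 2, but adding the
     scalar [y / 2] does not change its class and yields an integral one. *)
  rewrite -(one_plus_eps_scalar _ (y / 2)).
  have -> : mx2 (y / 2) 0 0 (- (y / 2)) + (y / 2)%:M = mx2 y 0 0 0.
    have -> : (y / 2)%:M = mx2 (y / 2) 0 0 (y / 2) by apply: mx2P; rewrite !mxE.
    by rewrite mx2D; congr mx2; field.
  by apply: Keps_one_plus_eps; rewrite mx2_mxOver ?rpred0.
- have := key (mx2 0 0 y 0); rewrite cM mx2M mx2_tr !(mulr0, mul0r, addr0, add0r); apply.
    by rewrite /sl2 /= mx2_tr addr0.
  by apply: Keps_one_plus_eps; rewrite mx2_mxOver ?rpred0.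
- have := key (mx2 0 y 0 0); rewrite cM mx2M mx2_tr !(mulr0, mul0r, addr0, add0r); apply.
    by rewrite /sl2 /= mx2_tr addr0.
  by apply: Keps_one_plus_eps; rewrite mx2_mxOver ?rpred0.
Qed.

Lemma centralizer_PGL2_of (Z : 'M[F]_2) : Z \in unitmx -> Z *m m = m *m Z ->
  centralizer m (PGL2_of Z).
Proof.
move=> uZ Zm; have [u uu E] := PGL2_mx_of uZ.
rewrite /centralizer /= E invmxZ ?unitmxZ//.
by rewrite -scalemxAl -scalemxAr -scalemxAl scalerA mulVr// scale1r Zm mulmxK.
Qed.

Lemma phi_equivariant Z N : Z \in unitmx -> N \in unitmx -> Z *m m = m *m Z ->
  phi (Z *m N) = chi (PGL2_of Z) * phi N.
Proof.
move=> uZ uN Zm; have [_ _ fz _] := fV.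
have uZN : Z *m N \in unitmx by rewrite unitmx_mul uZ.
have := fz _ (PGL2_of N) (centralizer_PGL2_of uZ Zm).
by rewrite -(PGL2_ofM uZ uN) (G_to_Geps_emb uZN) (G_to_Geps_emb uN).
Qed.

Lemma phi_nonzero x : f x != 0 -> exists2 M, M \in unitmx & phi M != 0.
Proof.
have [n [M [sn uM ->]]] := one_plus_eps_decomposition x two.
have [_ fe _ _] := fV; have := fe _ (PGL2_of M) sn.
rewrite (G_to_Geps_emb uM) => -> h; exists M => //.
by move: h; rewrite mulf_eq0 negb_or => /andP[].
Qed.

(** Left translation by the centralizer does not change [conj_mx m], so the bound on a compact set
    extends to the whole support. *)
Lemma phi_level_bounded : m != 0 -> exists n : nat, forall M, M \in unitmx ->
  phi M != 0 -> conj_mx m M \isn't a mxOver (@fideal F n%:Z).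
Proof.
move=> m0; have [_ _ _ [B cB fB]] := fV.
have [n hn] := compact_conj_bounded m0 cB; exists n => M uM h.
have /fB[z [b [zc Bb E]]] : [set g | f (G_to_Geps g) != 0] (PGL2_of M).
  by rewrite /= (G_to_Geps_emb uM).
have uz := PGL2_mx_unit z; have ub := PGL2_mx_unit b.
have uzb : PGL2_mx z *m PGL2_mx b \in unitmx by rewrite unitmx_mul uz.
have : PGL2_of M = PGL2_of (PGL2_mx z *m PGL2_mx b).
  by rewrite (PGL2_ofM uz ub) !PGL2_mxK.
move=> /(PGL2_of_eqP uM uzb)[u]; rewrite unitfE => u0 ->.
rewrite (conj_mxZ m u0 uzb).
have -> : conj_mx m (PGL2_mx z *m PGL2_mx b) = conj_mx m (PGL2_mx b).
  rewrite (conj_mxM m uz (mulmxV ub)) /conj_mx; congr (_ *m _ *m _).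
  rewrite /centralizer /= in zc; rewrite -[in LHS]zc.
  by rewrite !mulmxA mulVmx// mul1mx mulmxKV.
exact: hn.
Qed.

Section HeckeAction.
Local Notation q := (residue_card F).
Variable r : 'I_q -> F.
Hypotheses (r_oint : forall i, r i \in @oint F)
  (r_surj : forall x, x \in @oint F -> exists i, x - r i \in @fideal F 1)
  (r_inj : forall i j, r i - r j \in @fideal F 1 -> i = j).

(** For each neighbour, [q] cosets differ only in their infinitesimal part. As [A] is integral,
    [psi0] is trivial on that part, and the multiplicity [q] cancels against the normalization. *)
Lemma hecke_phi M a b c : M \in unitmx -> coords m M a b c ->
  [/\ a \in @oint F, b \in @oint F & c \in @oint F] ->
  hecke p 0 f (emb M) =
    \sum_i phi (M *m mx2 p (r i) 0 1) + phi (M *m mx2 1 0 0 p).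
Proof.
move=> uM cM [ai bi ci].
have q1 : (q%:R : C) != 0 by rewrite pnatr_eq0 -lt0n ltnW// (residue_reps F).1.
have uU i : mx2 p (r i) 0 1 \in unitmx by apply: mx2_unit; rewrite mulr1 mulr0 subr0.
have uL : mx2 1 0 0 p \in unitmx by apply: mx2_unit; rewrite mul1r mulr0 subr0.
have mean (v : 'I_q -> C) (u : C) :
    q%:R^-1 * (\sum_j \sum_(k < q) v j + \sum_(k < q) u) = \sum_j v j + u.
  have -> : \sum_j \sum_(k < q) v j = (\sum_j v j) *+ q.
    by rewrite -sumrMnl; apply: eq_bigr => j _; rewrite sumr_const card_ord.
  by rewrite sumr_const card_ord -mulrnDl -[(_ + _) *+ _]mulr_natl mulKf.
rewrite /hecke (hecke_sum p0 p1 r_oint r_surj r_inj _ fK) /hecke_mx.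
have E1 j k : f (emb M * PGL2_of (mx2 (dualC p) (dual (r j) (r k)) 0 1)%R)%g =
    phi (M *m mx2 p (r j) 0 1).
  have sN : sl2 (mx2 0 (r k) 0 0) by rewrite /sl2 /= mx2_tr addr0.
  rewrite (hecke_mx_upper _ _ p0) mulgA (phi_eps uM (uU j) sN).
  rewrite cM mx2M mx2_tr !(mulr0, mul0r, addr0, add0r) psi0_int ?mul1r//.
  by rewrite rpredM.
have E2 k : f (emb M * PGL2_of (mx2 1 0 (dual 0 (r k)) (dualC p))%R)%g =
    phi (M *m mx2 1 0 0 p).
  have sN : sl2 (mx2 0 0 (r k) 0) by rewrite /sl2 /= mx2_tr addr0.
  rewrite (hecke_mx_lower _ p0) mulgA (phi_eps uM uL sN).
  rewrite cM mx2M mx2_tr !(mulr0, mul0r, addr0, add0r) psi0_int ?mul1r//.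
  by rewrite rpredM.
rewrite (eq_bigr _ (fun j _ => eq_bigr _ (fun k _ => E1 j k))).
rewrite (eq_bigr _ (fun k _ => E2 k)).
exact: (mean (fun j => phi (M *m mx2 p (r j) 0 1)) _).
Qed.

End HeckeAction.

End Vertices.

(** * Eigenvectors on the tree *)

Lemma sqr_oint (F : nonarchLocalFieldType) (a : F) :
  a ^+ 2 \in @oint F -> a \in @oint F.
Proof.
rewrite /oint !in_fideal expf_eq0 /=; have [//|a0] := eqVneq a 0.
by rewrite /= expr2 ordvM//; lia.
Qed.

Section Tree.
Variables (R : realType) (F : nonarchLocalFieldType).
Local Notation C := R[i].
Local Notation q := (residue_card F).
Local Notation fid := (@fideal F).
Local Notation O := (@oint F).
Variable p : F.
Hypotheses (p0 : p != 0) (p1 : ordv p = 1).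
Variable r : 'I_q -> F.
Hypotheses (r_oint : forall i, r i \in O)
  (r_surj : forall x, x \in O -> exists i, x - r i \in fid 1)
  (r_inj : forall i j, r i - r j \in fid 1 -> i = j).
Variable m : 'M[F]_2.
Hypothesis m_det : \det m \in O.
Variables (phi : 'M[F]_2 -> C) (lam : C).
Hypothesis phiZ : forall a M, a != 0 -> M \in unitmx -> phi (a *: M) = phi M.
Hypothesis phiK : forall M H H', M \in unitmx -> H *m H' = 1%:M ->
  H \is a mxOver O -> H' \is a mxOver O -> phi (M *m H) = phi M.
Hypothesis phi_supp : forall M a b c, M \in unitmx -> coords m M a b c ->
  phi M != 0 -> [/\ a \in O, b \in O & c \in O].
Hypothesis phi_eigen : forall M a b c, M \in unitmx -> coords m M a b c ->
  [/\ a \in O, b \in O & c \in O] ->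
  lam * phi M = \sum_i phi (M *m mx2 p (r i) 0 1) + phi (M *m mx2 1 0 0 p).
Implicit Types (M H : 'M[F]_2) (a b c t : F).

Local Notation cb := (cheb q%:R lam).

Let q0 : (0 < q)%N. Proof. exact: ltnW (residue_reps F).1. Qed.

Let p_fid : p \in fid 1. Proof. by rewrite in_fideal p1 orbT. Qed.
Let O1 : 1 \in O. Proof. exact: rpred1. Qed.
Let O0 : 0 \in O. Proof. exact: rpred0. Qed.
Let O2 : 2 \in O. Proof. exact: rpred_nat. Qed.

Let unit_child M t : M \in unitmx -> M *m mx2 p t 0 1 \in unitmx.
Proof. by move=> uM; rewrite unitmx_mul uM mx2_unit// mulr1 mulr0 subr0. Qed.

Let unit_flip M : M \in unitmx -> M *m mx2 0 1 p 0 \in unitmx.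
Proof. by move=> uM; rewrite unitmx_mul uM mx2_unit// mulr0 mul1r sub0r oppr_eq0. Qed.

Lemma phi_swap M : M \in unitmx -> phi (M *m mx2 0 1 1 0) = phi M.
Proof.
move=> uM; apply: (phiK uM (H' := mx2 0 1 1 0)); rewrite ?mx2_mxOver//.
by rewrite mx2M mx2_1; congr mx2; ring.
Qed.

Lemma phi_shear M t : M \in unitmx -> t \in O -> phi (M *m mx2 1 t 0 1) = phi M.
Proof.
move=> uM tO; apply: (phiK uM (H' := mx2 1 (- t) 0 1)); rewrite ?mx2_mxOver ?rpredN//.
by rewrite mx2M mx2_1; congr mx2; ring.
Qed.

Lemma phi_rot M t : M \in unitmx -> t \in O -> phi (M *m mx2 t 1 1 0) = phi M.
Proof.
move=> uM tO; apply: (phiK uM (H' := mx2 0 1 1 (- t))); rewrite ?mx2_mxOver ?rpredN//.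
by rewrite mx2M mx2_1; congr mx2; ring.
Qed.

(* [mx2 1 0 0 p] is a step of the tree towards one neighbour, the parent; the
   remaining ones are the children, reached by [mx2 p t 0 1]. *)
Lemma parent_child M t : M \in unitmx -> t \in O ->
  phi (M *m mx2 p t 0 1 *m mx2 1 0 0 p) = phi M.
Proof.
move=> uM tO; have -> : M *m mx2 p t 0 1 *m mx2 1 0 0 p = p *: (M *m mx2 1 t 0 1).
  by rewrite scalemxAr -mulmxA mx2Z mx2M; congr (M *m mx2 _ _ _ _); ring.
rewrite phiZ ?phi_shear// unitmx_mul uM mx2_unit// mulr1 mulr0 subr0.
exact: oner_neq0.
Qed.

Lemma parent_flip M : M \in unitmx ->
  phi (M *m mx2 0 1 p 0 *m mx2 1 0 0 p) = phi M.
Proof.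
move=> uM; have -> : M *m mx2 0 1 p 0 *m mx2 1 0 0 p = p *: (M *m mx2 0 1 1 0).
  by rewrite scalemxAr -mulmxA mx2Z mx2M; congr (M *m mx2 _ _ _ _); ring.
rewrite phiZ ?phi_swap// unitmx_mul uM mx2_unit// mulr0 mulr1 sub0r oppr_eq0.
exact: oner_neq0.
Qed.

Lemma flip_parent M : M \in unitmx ->
  phi (M *m mx2 0 1 p 0) = phi (M *m mx2 1 0 0 p).
Proof.
move=> uM; rewrite -[RHS]phi_swap; last first.
  by rewrite unitmx_mul uM mx2_unit// mul1r mulr0 subr0.
by congr (phi _); rewrite -mulmxA mx2M; congr (M *m mx2 _ _ _ _); ring.
Qed.

(** [A] is the scalar [a] plus [mx2 0 b c (- 2 a)], so this says that [A] is scalar modulo [p^k].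
    Keeping [2 a] instead of [a] matters in residue characteristic 2. *)
Definition level k a b c := [&& b \in fid k, c \in fid k & 2 * a \in fid k].

(* All children of [M] are one level below [M]. *)
Definition descending k M := exists a b c,
  [/\ coords m M a b c, b \in fid (k - 1), b \notin fid k, c \in fid k &
      2 * a \in fid k].

(** The level bounds only [2 a]; integrality of [a] comes from [a^2 = - \det m - b c]. *)
Lemma level_integral (k : nat) M a b c : M \in unitmx -> coords m M a b c ->
  level k%:Z a b c -> [/\ a \in O, b \in O & c \in O].
Proof.
move=> uM cM /and3P[bk ck ak].
have bO : b \in O by apply: fidealW bk.
have cO : c \in O by apply: fidealW ck.
split=> //; apply: sqr_oint.
have -> : a ^+ 2 = - \det m - b * c by rewrite -(coords_det uM cM) addrK.
by rewrite rpredB ?rpredN ?rpredM.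
Qed.

Lemma quad_fideal k a b c t : t \in O -> level k a b c ->
  b + 2 * a * t - c * t ^+ 2 \in fid k.
Proof.
move=> tO /and3P[bk ck ak]; rewrite rpredB ?rpredD//; apply: fidealMr => //.
by rewrite rpredX.
Qed.

(** The new upper right coordinate is the value of the quadratic form divided by [p], so its
    valuation is exactly [k - 1]. *)
Lemma descending_child k M a b c t : M \in unitmx -> coords m M a b c -> t \in O ->
  level k a b c -> b + 2 * a * t - c * t ^+ 2 \notin fid (k + 1) ->
  descending k (M *m mx2 p t 0 1).
Proof.
move=> uM cM tO lev nQ; have cM' := coords_child p0 t uM cM.
have Qk := quad_fideal tO lev; have /and3P[bk ck ak] := lev.
exists (a - t * c), ((b + 2 * a * t - c * t ^+ 2) / p), (p * c); split=> //.
- by rewrite fidealVM// p1 subrK.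
- by rewrite fidealVM// p1.
- by apply: fidealMl => //; apply: fidealW p_fid.
by rewrite mulrBr rpredB// mulrCA; apply: fidealMl => //; apply: fidealMl.
Qed.

Lemma descending_flip k M a b c : M \in unitmx -> coords m M a b c ->
  level k a b c -> c \notin fid (k + 1) -> descending k (M *m mx2 0 1 p 0).
Proof.
move=> uM cM /and3P[bk ck ak] nc; have cM' := coords_flip p0 uM cM.
exists (- a), (c / p), (b * p); split=> //.
- by rewrite fidealVM// p1 subrK.
- by rewrite fidealVM// p1.
- by apply: fidealMr => //; apply: fidealW p_fid.
by rewrite mulrN rpredN.
Qed.

(** Induction on [k]. For [k = 0], [b] is not integral, so [phi M = 0]. Otherwise every child is
    descending one level lower with parent [M], and summing their relations in the eigenvector
    equation is the recurrence of [cheb]. No division is made, since [cb k] may vanish. *)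
Lemma descending_relation (k : nat) M : M \in unitmx -> descending k%:Z M ->
  cb k * phi (M *m mx2 1 0 0 p) = cb k.+1 * phi M.
Proof.
elim: k M => [|k IH] M uM [a [b [c [cM b1 bn ck ak]]]].
  suff -> : phi M = 0 by rewrite mul0r mulr0.
  by apply/eqP/negPn/negP => /(phi_supp uM cM)[_ bO _]; move: bn; rewrite bO.
have e1 : k.+1%:Z = k%:Z + 1 by rewrite -addn1 PoszD.
have lev : level k%:Z a b c.
  have kk : k%:Z <= k.+1%:Z by rewrite lez_nat.
  have b1' : b \in fid k%:Z by move: b1; rewrite e1 addrK.
  by rewrite /level b1' (fidealW kk ck) (fidealW kk ak).
have eig := phi_eigen uM cM (level_integral uM cM lev).
have child i : cb k.+1 * phi (M *m mx2 p (r i) 0 1) = cb k * phi M.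
  rewrite -(IH _ (unit_child _ uM)) ?parent_child//.
  apply: (descending_child uM cM (r_oint i) lev); rewrite -e1.
  apply: contraNN bn => h.
  have -> : b = (b + 2 * a * r i - c * r i ^+ 2) - (2 * a * r i - c * r i ^+ 2) by ring.
  by rewrite rpredB// rpredB//; apply: fidealMr => //; rewrite rpredX.
have -> : cb k.+1 * phi (M *m mx2 1 0 0 p) =
    cb k.+1 * (lam * phi M) - cb k.+1 * \sum_i phi (M *m mx2 p (r i) 0 1).
  by rewrite eig mulrDr addrAC subrr add0r.
rewrite mulr_sumr (eq_bigr _ (fun i _ => child i)) sumr_const card_ord.
by rewrite -[_ *+ _]mulr_natl chebSS; ring.
Qed.

(** * The cases at a vertex of maximal level [e] *)

Variable e : nat.
Hypothesis top : forall M a b c, M \in unitmx -> coords m M a b c ->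
  level e.+1%:Z a b c -> phi M = 0.
Hypothesis split_case : forall M a, M \in unitmx -> coords m M a 0 0 -> a != 0 ->
  phi M != 0 -> exists eta, [/\ is_root_of_unity eta,
    phi (M *m mx2 p 0 0 1) = eta * phi M & phi (M *m mx2 1 0 0 p) = eta^-1 * phi M].

Local Notation conclusion := (exists z : C,
  [/\ Weil_number q z, Weil_number q z^* & lam = z + z^*]).

Let eS : e.+1%:Z = e%:Z + 1. Proof. by rewrite -addn1 PoszD. Qed.

Let q1 : (1 < q)%N. Proof. exact: (residue_reps F).1. Qed.

(* [m] generates an unramified quadratic extension and [M] is the centre of its tree. *)
Lemma Weil_sum_inert M a b c : M \in unitmx -> coords m M a b c ->
  level e%:Z a b c -> phi M != 0 -> c \notin fid e.+1%:Z ->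
  (forall t, t \in O -> b + 2 * a * t - c * t ^+ 2 \notin fid e.+1%:Z) -> conclusion.
Proof.
move=> uM cM lev f0 cn Qn; apply: (@Weil_sum_int R q q.+1 e 0) => //.
  by rewrite normr0 add0r -addn1 PoszD.
rewrite subr0; apply: (mulIf f0).
have eig := phi_eigen uM cM (level_integral uM cM lev).
have child i : cb e.+1 * phi (M *m mx2 p (r i) 0 1) = cb e * phi M.
  have dc : descending e%:Z (M *m mx2 p (r i) 0 1).
    by apply: (descending_child uM cM (r_oint i) lev); rewrite -eS; apply: Qn.
  by rewrite -(descending_relation (unit_child _ uM) dc) parent_child.
have flip : cb e.+1 * phi (M *m mx2 1 0 0 p) = cb e * phi M.
  have dc : descending e%:Z (M *m mx2 0 1 p 0).
    by apply: (descending_flip uM cM lev); rewrite -eS.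
  by rewrite -(flip_parent uM) -(descending_relation (unit_flip uM) dc) parent_flip.
rewrite mulrAC eig mulrC mulrDr flip mulr_sumr (eq_bigr _ (fun i _ => child i)).
by rewrite sumr_const card_ord -[_ *+ _]mulr_natl -natr1; ring.
Qed.

(* Either [m] is nilpotent (or [chi] is ramified) and the support of [phi] ends at
   [M], or [m] generates a ramified quadratic extension and [M] is an end of the
   central edge of its tree. *)
Lemma Weil_sum_ramified M a b c : M \in unitmx -> coords m M a b c ->
  level e%:Z a b c -> phi M != 0 -> c \in fid e.+1%:Z -> 2 * a \in fid e.+1%:Z ->
  conclusion.
Proof.
move=> uM cM /and3P[be _ _] f0 ce ae.
have bn : b \notin fid e.+1%:Z.
  by apply: contraNN f0 => bS; rewrite (top uM cM)// /level bS ce ae.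
have dM : descending e.+1%:Z M.
  by exists a, b, c; split; rewrite ?eS ?addrK -?eS.
have rel := descending_relation uM dM.
set U := phi (M *m mx2 1 0 0 p) in rel.
have cM' := coords_flip p0 uM cM.
(* If [c] is divisible once more, the parent has level [e + 1], so [phi] vanishes there and
   [s = 0]. *)
have [c2|c2] := boolP (c \in fid e.+2%:Z).
  have U0 : U = 0.
    rewrite /U -(flip_parent uM); apply: (top (unit_flip uM) cM').
    rewrite /level mulrN rpredN ae andbT fidealVM// p1.
    rewrite -PoszD addn1 c2 /= eS; exact: fidealM.
  move: rel; rewrite U0 mulr0 => /esym/eqP; rewrite mulf_eq0 (negPf f0) orbF.
  rewrite chebSS subr_eq0 => /eqP rel.
  apply: (@Weil_sum_int R q q e 0) => //; last by rewrite subr0.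
  by rewrite normr0 add0r lerDl.
(* Otherwise the parent is descending as well, with [M] as its own parent, and the relation holds in
   both directions along this edge. *)
have dM' : descending e.+1%:Z (M *m mx2 0 1 p 0).
  exists (- a), (c / p), (b * p); split=> //.
  - by rewrite fidealVM// p1 subrK.
  - by rewrite fidealVM// p1 -PoszD addn1.
  - by rewrite eS; apply: fidealM.
  - by rewrite mulrN rpredN.
have := descending_relation (unit_flip uM) dM'.
rewrite (parent_flip uM) (flip_parent uM) -/U => rel'.
(* The symmetric and antisymmetric combinations correspond to [s = 1] and [s = -1]; [U + phi M] and
   [U - phi M] cannot both vanish. *)
have h1 : (cb e.+1 - cb e.+2) * (U + phi M) = 0.
  have -> : (cb e.+1 - cb e.+2) * (U + phi M) =
    cb e.+1 * U - cb e.+2 * phi M + (cb e.+1 * phi M - cb e.+2 * U) by ring.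
  by rewrite rel rel' !subrr addr0.
have h2 : (cb e.+1 + cb e.+2) * (U - phi M) = 0.
  have -> : (cb e.+1 + cb e.+2) * (U - phi M) =
    cb e.+1 * U - cb e.+2 * phi M - (cb e.+1 * phi M - cb e.+2 * U) by ring.
  by rewrite rel rel' !subrr.
move/eqP: h1; rewrite mulf_eq0 subr_eq0 => /orP[/eqP h1|/eqP h1].
  apply: (@Weil_sum_int R q q e 1) => //; first by rewrite addrC.
  move/eqP: h1; rewrite chebSS -subr_eq0 => /eqP h1.
  by apply/eqP; rewrite -subr_eq0 -oppr_eq0 -h1; apply/eqP; ring.
move/eqP: h2; rewrite mulf_eq0 => /orP[/eqP h2|].
  apply: (@Weil_sum_int R q q e (-1)) => //; first by rewrite normrN addrC.
  move: h2; rewrite chebSS rmorphN1 opprK mulrDl mul1r => h2.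
  by apply/eqP; rewrite -subr_eq0 -h2; apply/eqP; ring.
rewrite subr_eq0 => /eqP h2; move: h1; rewrite h2 -mulr2n => /eqP.
by rewrite mulrn_eq0 /= (negPf f0).
Qed.

(* [m] is split and [M] lies on its apartment. *)
Lemma Weil_sum_split M a : M \in unitmx -> coords m M a 0 0 -> phi M != 0 ->
  2 * a \in fid e%:Z -> 2 * a \notin fid e.+1%:Z -> conclusion.
Proof.
move=> uM cM f0 ae an.
have a0 : a != 0 by apply: contraNneq an => ->; rewrite mulr0 rpred0.
have [eta [eta_root fp fU]] := split_case uM cM a0 f0.
apply: (@Weil_sum_unity R q e eta) => //; apply: (mulIf f0).
have lev : level e%:Z a 0 0 by rewrite /level rpred0.
have eig := phi_eigen uM cM (level_integral uM cM lev).
have [i0 hi0] := r_surj O0; rewrite sub0r rpredN in hi0.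
have f_i0 : phi (M *m mx2 p (r i0) 0 1) = eta * phi M.
  (* The representative of the zero residue need not be [0]; an integral shear by [r i0 / p]
     corrects this. *)
  rewrite -fp -(@phi_shear (M *m mx2 p 0 0 1) (r i0 / p)).
  - by congr phi; rewrite -mulmxA mx2M; congr (M *m mx2 _ _ _ _); field.
  - by rewrite unitmx_mul uM mx2_unit// mulr1 mul0r subr0.
  - by rewrite /oint fidealVM// p1.
(* For the other [q - 1] children the quadratic form takes the value [2 a (r i)], with [r i] a unit,
   so its valuation is exactly [e]. *)
have child i : i != i0 -> cb e.+1 * phi (M *m mx2 p (r i) 0 1) = cb e * phi M.
  move=> ii0.
  have rn : r i \notin fid 1.
    by apply: contraNN ii0 => hi; apply/eqP/r_inj; rewrite rpredB.
  have [ri0 rv] : r i != 0 /\ ordv (r i) = 0 by apply: ordv_eqP; [apply: r_oint|].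
  have dc : descending e%:Z (M *m mx2 p (r i) 0 1).
    apply: (descending_child uM cM (r_oint i) lev); rewrite add0r mul0r subr0 -eS.
    apply: contraNN an => h; rewrite -[2 * a](mulfK ri0); apply: fidealMr => //.
    by rewrite in_fideal ordvV// rv oppr0 lexx orbT.
  by rewrite -(descending_relation (unit_child _ uM) dc) parent_child.
rewrite [LHS]mulrAC mulrBl eig fU (bigD1 i0)//= f_i0.
rewrite [(_ - _) * _](_ : _ =
  cb e.+1 * \sum_(i | i != i0) phi (M *m mx2 p (r i) 0 1)); last by ring.
rewrite mulr_sumr (eq_bigr _ child) sumr_const cardC1 card_ord.
by rewrite -[_ *+ _]mulr_natl mulrA.
Qed.

(** If the quadratic form has no zero modulo [p^(e+1)], the point at infinity included, the case is
    inert. Otherwise a rotation moves a zero to infinity, which makes [c] divisible; then [2 a]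
    decides between a double zero and two distinct ones, the latter lifting to a diagonalization of
    [m]. *)
Lemma Weil_sum_top M a b c : M \in unitmx -> coords m M a b c ->
  level e%:Z a b c -> phi M != 0 -> conclusion.
Proof.
have red N a' b' c' : N \in unitmx -> coords m N a' b' c' ->
    level e%:Z a' b' c' -> phi N != 0 -> c' \in fid e.+1%:Z -> conclusion.
  move=> uN cN lev g0 cn.
  have [an|an] := boolP (2 * a' \in fid e.+1%:Z); first exact: Weil_sum_ramified cN lev g0 cn an.
  have /and3P[be ce ae] := lev.
  have [av0 av] : 2 * a' != 0 /\ ordv (2 * a') = e%:Z by apply: ordv_eqP; rewrite -?eS.
  (* Dividing [b + 2 a t - c t^2 = 0] by [2 a], of valuation exactly [e], gives a fixed point
     equation with coefficient [c / (2 a)] in the maximal ideal. *)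
  have [t tO tE] : exists2 t, t \in O & t = - b' / (2 * a') + c' / (2 * a') * t ^+ 2.
    by apply: quadratic_fixpoint; rewrite /oint fidealVM ?rpredN// av ?add0r// addrC -eS.
  have Q0 : b' + 2 * a' * t - c' * t ^+ 2 = 0.
    rewrite {1}tE; field.
    by move: av0; rewrite mulf_eq0 negb_or => /andP[-> ->].
  have uN1 : N *m mx2 t 1 1 0 \in unitmx.
    by rewrite unitmx_mul uN mx2_unit// mulr0 mul1r sub0r oppr_eq0 oner_neq0.
  have := coords_rot t uN cN; rewrite Q0 => cN1.
  have g1 := phi_rot uN tO.
  set a1 := c' * t - a' in cN1.
  have a1e : 2 * a1 \in fid e%:Z.
    by rewrite mulrBr rpredB//; apply: fidealMl => //; apply: fidealMr.
  have a1n : 2 * a1 \notin fid e.+1%:Z.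
    apply: contraNN an => h; have -> : 2 * a' = 2 * (c' * t) - 2 * a1 by rewrite /a1; ring.
    by rewrite rpredB//; apply: fidealMl => //; apply: fidealMr.
  have [av0' av'] : 2 * a1 != 0 /\ ordv (2 * a1) = e%:Z by apply: ordv_eqP; rewrite -?eS.
  (* After the rotation the lower left coordinate is zero; this shear kills the upper right one. *)
  pose s := - c' / (2 * a1).
  have sO : s \in O by rewrite /oint fidealVM ?rpredN// av' add0r.
  have uN2 : N *m mx2 t 1 1 0 *m mx2 1 s 0 1 \in unitmx.
    by rewrite unitmx_mul uN1 mx2_unit// mulr1 mulr0 subr0 oner_neq0.
  have := coords_shear s uN1 cN1; rewrite mulr0 subr0 mul0r subr0.
  have -> : c' + 2 * a1 * s = 0 by rewrite /s mulrC divfK// subrr.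
  move=> cN2; apply: (Weil_sum_split uN2 cN2 _ a1e a1n).
  by rewrite (phi_shear uN1 sO) g1.
move=> uM cM lev f0.
have [cn|cn] := boolP (c \in fid e.+1%:Z); first exact: red cM lev f0 cn.
have [[t tO Qt]|nQ] := pselect (exists2 t, t \in O &
    b + 2 * a * t - c * t ^+ 2 \in fid e.+1%:Z); last first.
  apply: (Weil_sum_inert uM cM lev f0 cn) => t tO.
  by apply/negP => Qt; apply: nQ; exists t.
have uN : M *m mx2 t 1 1 0 \in unitmx.
  by rewrite unitmx_mul uM mx2_unit// mulr0 mul1r sub0r oppr_eq0 oner_neq0.
have /and3P[be ce ae] := lev.
apply: (red _ _ _ _ uN (coords_rot t uM cM)) => //; last by rewrite (phi_rot uM tO).
rewrite /level ce (quad_fideal tO lev) /= mulrBr rpredB//.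
by apply: fidealMl => //; apply: fidealMr.
Qed.

End Tree.

Theorem proposition5p2
  (R : realType) (F : nonarchLocalFieldType) (char_neq2 : 2%N \notin [pchar F])
  (varpi : F) (varpi_unif : uniformizer varpi)
  (psi0 : F -> R[i]) (psi0_char : additive_character psi0)
  (psi0_cond :
    [set x | forall y, integers y -> psi0 (x * y) = 1] = @integers F)
  (m : 'M[F]_2) (m_neq0 : m != 0) (m_sl2 : sl2 m)
  (chi : PGL2 F -> R[i]) (chi_char : character (centralizer m) chi)
  (finite_dim : finite_dimensional (Kinvariants (Vspace psi0 m chi)))
  (hecke_indep : forall x y : F, integers x -> integers y ->
    forall f, Kinvariants (Vspace psi0 m chi) f ->
      hecke varpi x f = hecke varpi y f)
  (unramified : forall (c : F) (P : 'M[F]_2),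
    c != 0 -> eigenvalue m c -> P \in unitmx ->
    P *m m *m invmx P = diag2 c (- c) ->
    is_conductor varpi
      (fun x => chi (PGL2_of (invmx P *m diag2 x 1 *m P))) 0 ->
    forall z, centralizer m z -> is_root_of_unity (chi z))
  (lambda : R[i]) :
  eigenvalue_on (Kinvariants (Vspace psi0 m chi)) (hecke varpi 0) lambda ->
  exists z : R[i], [/\ Weil_number (residue_card F) z,
    Weil_number (residue_card F) z^* & lambda = z + z^*].
Proof.
move=> [f [[fV fK] [x0 fx0] Tf]] {finite_dim hecke_indep psi0_char}.
have two : (2 : F) != 0.
  by apply: contraNneq char_neq2 => t; rewrite inE /= t eqxx.
have [p0 p1] := uniformizer_ordv varpi_unif.
have [_ [r [r_oint r_surj r_inj]]] := residue_reps F.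
have [M0 uM0 fM0] := phi_nonzero two fV fx0.
have c0 := coords_exist m_sl2 uM0.
have [a0i b0i c0i] := phi_support two psi0_cond fV fK uM0 c0 fM0.
have m_det : \det m \in @oint F.
  by rewrite -rpredN -(coords_det uM0 c0) rpredD ?rpredM ?rpredX.
have eigen M a b c : M \in unitmx -> coords m M a b c ->
    [/\ a \in @oint F, b \in @oint F & c \in @oint F] ->
    lambda * phi f M = \sum_i phi f (M *m mx2 varpi (r i) 0 1) +
      phi f (M *m mx2 1 0 0 varpi).
  move=> uM cM abc; rewrite -(hecke_phi p0 p1 psi0_cond fV fK r_oint r_surj r_inj uM cM abc).
  exact: esym (Tf _).
have phiZ := @phiZ R F f; have phiK := @phiK R F f fK.
have supp := @phi_support R F two psi0 m chi psi0_cond f fV fK.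
have [n hn] := phi_level_bounded fV m_neq0.
pose good (e : nat) := `[< exists M a b c, [/\ M \in unitmx, coords m M a b c,
   level e%:Z a b c & phi f M != 0] >].
have good0 : exists e, good e.
  exists 0%N; apply/asboolP; exists M0, (conj_mx m M0 0 0), (conj_mx m M0 0 1), (conj_mx m M0 1 0).
  split=> //; rewrite /level b0i c0i /=; apply: fidealMl a0i.
  exact: rpred_nat.
(* The bound [n] concerns the entries of [A], whereas the level sees only [2 a]; hence the extra
   term. *)
have good_le e : good e -> (e <= n + `|ordv (2%:R : F)%R|)%N.
  move=> /asboolP[M [a [b [c [uM cM /and3P[be ce ae] fM]]]]].
  rewrite leqNgt; apply/negP => lt; have /negP := hn M uM fM; apply.
  have half x : 2 * x \in @fideal F e%:Z -> x \in @fideal F n%:Z.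
    move=> h; have -> : x = 2 * x / 2 by rewrite mulrC mulKf.
    rewrite fidealVM//; apply: fidealW h.
    by move: (ordv _) lt => v lt; clear -lt; lia.
  have two_int : 2 \in @oint F by apply: rpred_nat.
  have hb := half b (fidealMl two_int be); have hc := half c (fidealMl two_int ce).
  by rewrite cM; apply: mx2_mxOver; rewrite ?rpredN //; apply: half.
have [e /asboolP[M [a [b [c [uM cM lev fM]]]]] emax] := ex_maxnP good0 good_le.
apply: (@Weil_sum_top R F varpi p0 p1 r r_oint r_surj r_inj m m_det (phi f)
  lambda phiZ phiK supp eigen e _ _ M a b c uM cM lev fM).
  move=> N a' b' c' uN cN lev'; apply/eqP/negPn/negP => fN.
  suff /emax : good e.+1 by rewrite ltnn.
  by apply/asboolP; exists N, a', b', c'.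
move=> {M a b c uM cM lev fM} M a uM cM an fM.
have MD : m *m M = M *m mx2 a 0 0 (- a).
  by rewrite -cM /conj_mx !mulmxA mulmxV// mul1mx.
(* At [M] the conjugate of [m] is diagonal, so [Z x] centralizes [m] and translates along the
   apartment through [M], where [phi] changes by the value of [chi]. *)
pose Z (x : F) := M *m mx2 x 0 0 1 *m invmx M.
have ux (x : F) : x != 0 -> mx2 x 0 0 1 \in unitmx.
  by move=> xn; rewrite mx2_unit// mulr1 mulr0 subr0.
have uZ (x : F) : x != 0 -> Z x \in unitmx.
  by move=> xn; rewrite !unitmx_mul uM ux// unitmx_inv.
have ZM (x : F) : Z x *m M = M *m mx2 x 0 0 1 by rewrite mulmxKV.
have Zm (x : F) : Z x *m m = m *m Z x.
  have comm : mx2 x 0 0 1 *m mx2 a 0 0 (- a) = mx2 a 0 0 (- a) *m mx2 x 0 0 1.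
    by rewrite !mx2M; congr mx2; ring.
  apply: (can_inj (mulmxK uM)); rewrite /= -[LHS]mulmxA MD mulmxA ZM.
  by rewrite -[LHS]mulmxA comm -[RHS]mulmxA ZM [RHS]mulmxA MD mulmxA.
have equi (x : F) : x != 0 -> phi f (M *m mx2 x 0 0 1) = chi (PGL2_of (Z x)) * phi f M.
  by move=> xn; rewrite -ZM (phi_equivariant fV (uZ x xn) uM (Zm x)).
have ZE (x : F) : invmx (invmx M) *m diag2 x 1 *m invmx M = Z x by rewrite invmxK diag2E.
have uMV : invmx M \in unitmx by rewrite unitmx_inv.
have [_ chi_neq0 _] := chi_char.
have zc (x : F) : x != 0 -> centralizer m (PGL2_of (Z x)).
  by move=> xn; apply: centralizer_PGL2_of (uZ x xn) (Zm x).
exists (chi (PGL2_of (Z varpi))); split.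
- apply: (unramified a (invmx M) an _ uMV _ _ _ (zc _ p0)).
  + apply/eigenvalueP; exists (row 0 (invmx M)).
      rewrite -row_mul -[m](mulmxK uM) MD !mulmxA mulVmx// mul1mx.
      rewrite row_mul; have -> : row 0 (mx2 a 0 0 (- a)) = a *: row 0 (1%:M : 'M[F]_2).
        apply/rowP => j; rewrite !mxE /=.
        by rewrite [0 == j]eq_sym; case: (j == 0) => /=; rewrite ?mulr1 ?mulr0.
      by rewrite -scalemxAl -row_mul mul1mx.
    apply/negP => /eqP r0; have /negP := oner_neq0 F; apply.
    have : row 0 (invmx M) *m M = row 0 (1%:M) by rewrite -row_mul mulVmx.
    by rewrite r0 mul0mx => /rowP/(_ 0); rewrite !mxE /= => ->.
  + by rewrite invmxK diag2E -cM.
  (* For a unit [x] the matrix [mx2 x 0 0 1] is in [GL_2(O)] and fixes the vertex, so [phi f M != 0]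
     forces [chi] to be unramified. *)
  + split; last by move=> k _; exact: leq0n.
    move=> x [xn xv]; rewrite ZE; apply: (mulIf fM); rewrite mul1r -(equi x xn).
    apply: (phiK M _ (mx2 x^-1 0 0 1) uM).
    * by rewrite mx2M mx2_1; congr mx2; field.
    * by rewrite mx2_mxOver ?rpred0 ?rpred1// /oint in_fideal xv orbT.
    * by rewrite mx2_mxOver ?rpred0 ?rpred1// /oint in_fideal ordvV// xv orbT.
- exact: equi.
have uN : M *m mx2 1 0 0 varpi \in unitmx.
  by rewrite unitmx_mul uM mx2_unit// mul1r mulr0 subr0.
have := phi_equivariant fV (uZ _ p0) uN (Zm varpi).
(* [Z varpi] carries the opposite neighbour on the apartment back to [M], whence the inverse of
   [eta]. *)
have -> : Z varpi *m (M *m mx2 1 0 0 varpi) = varpi *: M.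
  rewrite mulmxA ZM -mulmxA mx2M -[varpi *: M]mulmx1 -scalemxAl scalemxAr mx2_1 mx2Z.
  by congr (_ *m mx2 _ _ _ _); ring.
by rewrite (phiZ varpi M p0 uM) => ->; rewrite mulKf// chi_neq0//; apply: zc.
Qed.
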